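(* The pseudo-marginal Markov operator $\tilde P$ is positive, i.e. $\langle f,\tilde Pf\rangle_{\tilde\pi}\ge0$ for all $f:\mathsf X\times\mathsf W\to\mathbb R$ with $\tilde\pi(f^2)<\infty$, and therefore admits a left spectral gap ($\operatorname{Gap}_L(\tilde P)>0$), in the following cases: (a) if the marginal algorithm is an independent Metropolis--Hastings (IMH) algorithm; (b) if the marginal algorithm is a random-walk Metropolis (RWM) algorithm with a proposal density which can be written in the form $$q(x,y)=\int\eta(z,x)\eta(z,y)\,\mathrm dz$$ for some function $\eta$.
   Context: Let $(\mathsf X,\mathcal B(\mathsf X))$ be a measurable space, $\pi$ a probability measure on it and $q(x,\mathrm dy)$ a Markov kernel on $\mathsf X$. The function $r(x,y)=\frac{\pi(\mathrm dy)q(y,\mathrm dx)}{\pi(\mathrm dx)q(x,\mathrm dy)}$ is the Radon--Nikodym derivative in the sense of Tierney: there is a symmetric measurable set $R\subset\mathsf X^2$ on which the measures $\pi(\mathrm dx)q(x,\mathrm dy)$ and $\pi(\mathrm dy)q(y,\mathrm dx)$ are mutually absolutely continuous, and on whose complement they are mutually singular; on $R$, $r$ is the density of the second with respect to the first, with values in $(0,\infty)$ and $r(x,y)r(y,x)=1$; off $R$, $r:=0$. The marginal algorithm is the Metropolis--Hastings kernel $P(x,\mathrm dy)=\min\{1,r(x,y)\}q(x,\mathrm dy)+\delta_x(\mathrm dy)\rho(x)$ with $\rho(x)=1-\int\min\{1,r(x,y)\}q(x,\mathrm dy)$. IMH: $q(x,\mathrm dy)=q(\mathrm dy)$ for all $x$,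 where $q$ is a probability measure with $\pi\ll q$. RWM: $\mathsf X=\mathbb R^d$, $\pi$ has a density (also denoted $\pi$) with respect to Lebesgue measure, and $q(x,\mathrm dy)=q(x,y)\,\mathrm dy$ with $q(x,y)=\tilde q(y-x)$ for a symmetric probability density $\tilde q$, so that $r(x,y)=\pi(y)/\pi(x)$. Let $\mathsf W$ be a Borel subset of $\mathbb R_+=[0,\infty)$ and let $x\mapsto Q_x$ be a probability kernel from $\mathsf X$ to $\mathsf W$ with $\int w\,Q_x(\mathrm dw)=1$ for all $x$. Put $\pi_x(\mathrm dw)=w\,Q_x(\mathrm dw)$ and $\tilde\pi(\mathrm dx,\mathrm dw)=\pi(\mathrm dx)\pi_x(\mathrm dw)$. The pseudo-marginal kernel is $\tilde P(x,w;\mathrm dy,\mathrm du)=\min\{1,r(x,y)\frac uw\}q(x,\mathrm dy)Q_y(\mathrm du)+\delta_{x,w}(\mathrm dy,\mathrm du)\tilde\rho(x,w)$ with $\tilde\rho(x,w)=1-\iint\min\{1,r(x,y)\frac uw\}q(x,\mathrm dy)Q_y(\mathrm du)$; it is reversible with respect to $\tilde\pi$. (If $0\in\mathsf W$, read $\min\{1,r(x,y)u/w\}$ as $1$ for $w=0$; the set $\{w=0\}$ is $\tilde\pi$-null.) For a Markov kernel $\Pi$ reversible with respect to a probability $\mu$, $\langle f,g\rangle_\mu=\int fg\,\mathrm d\mu$ and the left spectral gap is $\operatorname{Gap}_L(\Pi)=1+\inf\{\langle g,\Pi g\rangle_\mu:\mu(g)=0,\ \mu(g^2)=1\}$. *)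

(* Defs.v *)
From HB Require Import structures.
From mathcomp Require Import all_boot all_order all_algebra.
From mathcomp Require Import all_classical all_reals all_analysis.
From mathcomp Require Import measurable_realfun.

Set Implicit Arguments.
Unset Strict Implicit.
Unset Printing Implicit Defensive.

Import Order.TTheory GRing.Theory Num.Theory.
Import numFieldNormedType.Exports.
Local Open Scope classical_set_scope.
Local Open Scope ring_scope.
Local Open Scope ereal_scope.

(* mu(dx) K(x, dy) *)
Section semidirect.
Context d d' (X : measurableType d) (Y : measurableType d') (R : realType).

Definition semidirect (mu : {measure set X -> \bar R}) (K : R.-pker X ~> Y)
  (A : set (X * Y)) : \bar R := \int[mu]_x K x (xsection A x).

Variables (mu : {measure set X -> \bar R}) (K : R.-pker X ~> Y).

Lemma measurable_kernel_xsection (A : set (X * Y)) : measurable A ->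
  measurable_fun [set: X] (fun x => K x (xsection A x) : \bar R).
Proof. by move=> mA; apply: measurable_fun_xsection_finite_kernel; rewrite inE. Qed.

Let sd0 : semidirect mu K set0 = 0.
Proof. by rewrite /semidirect integral0_eq// => x _; rewrite xsection0. Qed.

Let sd_ge0 A : 0 <= semidirect mu K A.
Proof. exact: integral_ge0. Qed.

Let sd_sigma_additive : semi_sigma_additive (semidirect mu K).
Proof.
move=> F mF tF mUF.
rewrite [X in _ --> X](_ : _ = \sum_(n <oo) semidirect mu K (F n)).
  by apply/cvg_closeP; split; [exact: is_cvg_nneseries|rewrite closeE].
rewrite /semidirect -integral_nneseries//; last first.
  by move=> n; exact: measurable_kernel_xsection.
apply: eq_integral => x _; apply/esym/cvg_lim => //=; rewrite xsection_bigcup.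
apply: (measure_sigma_additive _ (trivIset_xsection tF)) => ?.
exact: measurable_xsection.
Qed.

HB.instance Definition _ := isMeasure.Build _ _ _ (semidirect mu K)
  sd0 sd_ge0 sd_sigma_additive.

End semidirect.

Section semidirect_probability.
Context d d' (X : measurableType d) (Y : measurableType d') (R : realType).
Variables (mu : probability X R) (K : R.-pker X ~> Y).

Let sdT : semidirect mu K setT = 1.
Proof.
rewrite /semidirect (eq_integral (cst 1)); last first.
  by move=> x _; rewrite xsectionE preimage_setT prob_kernel.
rewrite integral_cst// mul1e. exact: probability_setT.
Qed.

HB.instance Definition _ := Measure_isProbability.Build _ _ _
  (semidirect mu K) sdT.

End semidirect_probability.

(* K(x, dy) Q(y, du), as a kernel from X * U that ignores the U-component *)
Section lifted_proposal.
Context d d' (X : measurableType d) (U : measurableType d') (R : realType).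
Variables (q : R.-pker X ~> X) (Q : R.-pker X ~> U).

Definition lifted_proposal (s : X * U) : {measure set (X * U) -> \bar R} :=
  semidirect (q s.1) Q.

Let measurable_lifted A : measurable A ->
  measurable_fun [set: X * U] (lifted_proposal ^~ A).
Proof.
move=> mA; rewrite /lifted_proposal /semidirect.
apply: (@measurableT_comp _ _ _ _ _ _
  (fun x => \int[q x]_y Q y (xsection A y)) _ fst) => //.
apply: measurable_fun_integral_kernel => //.
- by move=> B mB; exact: measurable_kernel.
- exact: measurable_kernel_xsection.
Qed.

HB.instance Definition _ := isKernel.Build _ _ _ _ _
  lifted_proposal measurable_lifted.

Let liftedT s : lifted_proposal s setT = 1.
Proof.
rewrite /lifted_proposal /= /semidirect (eq_integral (cst 1)); last first.
  by move=> x _; rewrite xsectionE preimage_setT prob_kernel.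
by rewrite integral_cst// mul1e prob_kernel.
Qed.

HB.instance Definition _ := Kernel_isProbability.Build _ _ _ _ _
  lifted_proposal liftedT.

End lifted_proposal.

(* Metropolis-Hastings kernel with proposal K and acceptance probability a:
   a(s,t) K(s,dt) + delta_s(dt) (1 - \int a(s,t) K(s,dt)).  The proof arguments
   of mh_kernel only carry the hypotheses under which it is a Markov kernel. *)
Section metropolis_hastings.
Context d (S : measurableType d) (R : realType) (K : R.-pker S ~> S).
Variable a : S * S -> R.

Definition rejection (s : S) : \bar R := 1 - \int[K s]_t (a (s, t))%:E.

Hypotheses (ma : measurable_fun [set: S * S] a) (a01 : forall z, (0 <= a z <= 1)%R).

Definition mh_kernel of measurable_fun [set: S * S] a & (forall z, (0 <= a z <= 1)%R)
  := fun (s : S) (A : set S) =>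
  \int[K s]_(t in A) (a (s, t))%:E + rejection s * \d_s A.

Local Notation P := (mh_kernel ma a01).

Let ma1 s : measurable_fun [set: S] (fun t => (a (s, t))%:E).
Proof. by apply/measurable_EFinP; exact: (measurableT_comp ma). Qed.

Let a_ge0 s t : 0 <= (a (s, t))%:E.
Proof. by rewrite lee_fin; case/andP: (a01 (s, t)). Qed.

Let int_le1 s : \int[K s]_t (a (s, t))%:E <= 1.
Proof.
apply: (@le_trans _ _ (\int[K s]_t (cst 1) t)).
  apply: ge0_le_integral => //.
  by move=> t _; rewrite lee_fin; case/andP: (a01 (s, t)).
by rewrite integral_cst// mul1e prob_kernel.
Qed.

Let int_fin s : \int[K s]_t (a (s, t))%:E \is a fin_num.
Proof.
by rewrite ge0_fin_numE ?integral_ge0// (le_lt_trans (int_le1 s)) ?ltry.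
Qed.

Lemma rejection_ge0 s : 0 <= rejection s.
Proof. by rewrite /rejection sube_ge0 ?int_fin. Qed.

Let mh0 s : P s set0 = 0.
Proof. by rewrite /mh_kernel integral_set0 measure0 mule0 adde0. Qed.

Let mh_ge0 s A : 0 <= P s A.
Proof.
by rewrite adde_ge0//; [exact: integral_ge0|rewrite mule_ge0// rejection_ge0].
Qed.

Let mh_sigma_additive s : semi_sigma_additive (P s).
Proof.
move=> F mF tF mUF; rewrite /mh_kernel.
rewrite [X in X @ _ --> _](_ : _ = (fun n =>
    \sum_(0 <= i < n) \int[K s]_(t in F i) (a (s, t))%:E +
    \sum_(0 <= i < n) rejection s * \d_s (F i))); last first.
  by apply/funext => n; rewrite big_split.
apply: cvgeD.
- by rewrite ge0_adde_def// inE ?integral_ge0// mule_ge0// rejection_ge0.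
- rewrite ge0_integral_bigcup//; last by apply: measurable_funTS.
  by apply: is_cvg_ereal_nneg_natsum => n _; exact: integral_ge0.
- rewrite (_ : (fun n => _) = (fun n => rejection s *
      \sum_(0 <= i < n) \d_s (F i))); last first.
    by apply/funext => n; rewrite ge0_sume_distrr.
  apply: cvgeZl; first by rewrite /rejection fin_numB int_fin.
  exact: measure_semi_sigma_additive.
Qed.

HB.instance Definition _ s := isMeasure.Build _ _ _ (P s)
  (mh0 s) (mh_ge0 s) (@mh_sigma_additive s).

Definition mh : S -> {measure set S -> \bar R} := fun s => P s.

Let measurable_mh A : measurable A -> measurable_fun [set: S] (mh ^~ A).
Proof.
have mint (B : set S) : measurable B ->
    measurable_fun [set: S] (fun s => \int[K s]_(t in B) (a (s, t))%:E).
  move=> mB.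
  rewrite (_ : (fun s => _) = (fun s =>
      \int[K s]_t (a (s, t) * \1_B t)%:E)); last first.
    apply/funext => s; rewrite integral_mkcond; apply: eq_integral => t _.
    rewrite patchE indicE; case: ifPn => tB; first by rewrite mulr1.
    by rewrite mulr0.
  apply: (measurable_fun_integral_finite_kernel
    (fun z => (a z * \1_B z.2)%:E)) => //.
    by move=> z; rewrite lee_fin mulr_ge0//; case/andP: (a01 z).
  apply/measurable_EFinP; apply: measurable_funM => //.
  by apply: measurableT_comp => //; exact: measurable_indic.
move=> mA; apply: emeasurable_funD; first exact: mint.
apply: emeasurable_funM.
  by apply: emeasurable_funB => //; exact: mint.
rewrite [X in measurable_fun _ X](_ : _ = EFin \o mindic R mA)//.
exact/measurable_EFinP.
Qed.

HB.instance Definition _ := isKernel.Build _ _ _ _ _ mh measurable_mh.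

Let mhT s : mh s setT = 1.
Proof. by rewrite /mh /= /mh_kernel diracT mule1 /rejection addeC subeK. Qed.

HB.instance Definition _ := Kernel_isProbability.Build _ _ _ _ _ mh mhT.

End metropolis_hastings.

(* Acceptance ratio in the sense of Tierney: on a symmetric region,
   pi(dx)q(x,dy) (fwd) and pi(dy)q(y,dx) (bwd) are equivalent and the ratio is
   the density of the latter with respect to the former; off the region they
   are mutually singular and the ratio is 0. *)
Record tierney_ratio d (X : measurableType d) (R : realType)
    (pi : probability X R) (q : R.-pker X ~> X)
    (fwd := semidirect pi q)
    (bwd := pushforward (semidirect pi q) (fun z : X * X => (z.2, z.1))) :=
  TierneyRatio {
    ratio :> X * X -> R ;
    region : set (X * X) ;
    measurable_ratio : measurable_fun setT ratio ;
    measurable_region : measurable region ;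
    region_sym : forall x y, region (x, y) -> region (y, x) ;
    region_equivalent : forall A, measurable A -> A `<=` region ->
      (fwd A = 0 <-> bwd A = 0) ;
    region_singular : exists2 B, measurable B &
      [/\ B `<=` ~` region, fwd B = 0 & bwd (~` region `\` B) = 0] ;
    ratio_density : forall A, measurable A -> A `<=` region ->
      bwd A = \int[fwd]_(z in A) (ratio z)%:E ;
    ratio_gt0 : forall z, region z -> (0 < ratio z)%R ;
    ratioV : forall x y, region (x, y) -> (ratio (x, y) * ratio (y, x) = 1)%R ;
    ratio_off : forall z, ~ region z -> ratio z = 0%R }.

Lemma tierney_ratio_ge0 d (X : measurableType d) (R : realType)
  (pi : probability X R) (q : R.-pker X ~> X) (r : tierney_ratio pi q) z :
  (0 <= r z)%R.
Proof.
have [rz|rz] := pselect (region r z); first exact/ltW/ratio_gt0.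
by rewrite ratio_off.
Qed.

(* The nonemptiness needed by measurableType is no restriction: it follows from
   the existence of a probability kernel into the set. *)
Record nneg_borel (R : realType) := NnegBorel {
  nneg_borel_set :> set R ;
  measurable_nneg_borel : measurable nneg_borel_set ;
  nneg_borel_ge0 : nneg_borel_set `<=` `[0%R, +oo[ ;
  nneg_borel_nonempty : nneg_borel_set !=set0 }.

(* The subspace W of the real line, with its trace sigma-algebra. *)
Definition weight_space (R : realType) (W : nneg_borel R) : Type :=
  set_type (nneg_borel_set W).

Section weight_space.
Variables (R : realType) (W : nneg_borel R).

Definition weight (w : weight_space W) : R := val w.

HB.instance Definition _ := gen_eqMixin (weight_space W).
HB.instance Definition _ := gen_choiceMixin (weight_space W).

Let weight_point : weight_space W.
Proof.
by have [w Ww] := cid (nneg_borel_nonempty W); exists w; rewrite inE.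
Qed.

HB.instance Definition _ := isPointed.Build (weight_space W) weight_point.

Let weight_measurable : set (set (weight_space W)) :=
  preimage_set_system setT weight measurable.

Let weight_sigma_algebra : sigma_algebra setT weight_measurable.
Proof. exact/sigma_algebra_preimage/sigma_algebra_measurable. Qed.

Let weight_measurableC A : weight_measurable A -> weight_measurable (~` A).
Proof. by case: weight_sigma_algebra => _ + _ mA => /(_ _ mA); rewrite setTD. Qed.

Let weight_measurable_bigcup (F : (set (weight_space W))^nat) :
  (forall i, weight_measurable (F i)) -> weight_measurable (\bigcup_i F i).
Proof. by case: weight_sigma_algebra => _ _; exact. Qed.

HB.instance Definition _ := @isMeasurable.Build (preimage_display weight)
  (weight_space W) weight_measurable
  (let: And3 w0 _ _ := weight_sigma_algebra in w0)
  weight_measurableC weight_measurable_bigcup.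

Lemma measurable_weight : measurable_fun [set: weight_space W] weight.
Proof. by move=> _ B mB; exists B. Qed.

Lemma weight_ge0 w : (0 <= weight w)%R.
Proof.
have := nneg_borel_ge0 (set_valP w).
by rewrite /= in_itv/= andbT.
Qed.

End weight_space.

Record weight_kernel d (X : measurableType d) (R : realType)
    (W : nneg_borel R) := WeightKernel {
  weight_ker :> R.-pker X ~> weight_space W ;
  weight_mean1 : forall x, \int[weight_ker x]_w (weight w)%:E = 1 }.

(* pi_x(dw) = w Q_x(dw) *)
Section tilted.
Context d (X : measurableType d) (R : realType) (W : nneg_borel R).
Variable Q : weight_kernel X W.

Definition tilted_set (x : X) (A : set (weight_space W)) : \bar R :=
  \int[Q x]_(w in A) (weight w)%:E.

Let mw : measurable_fun [set: weight_space W] (fun w => (weight w)%:E).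
Proof. exact/measurable_EFinP/measurable_weight. Qed.

Let w_ge0 (w : weight_space W) : 0 <= (weight w)%:E.
Proof. by rewrite lee_fin weight_ge0. Qed.

Let tilted0 x : tilted_set x set0 = 0.
Proof. by rewrite /tilted_set integral_set0. Qed.

Let tilted_ge0 x A : 0 <= tilted_set x A.
Proof. by apply: integral_ge0. Qed.

Let tilted_sigma_additive x : semi_sigma_additive (tilted_set x).
Proof.
move=> F mF tF mUF; rewrite /tilted_set ge0_integral_bigcup//; last first.
  exact: measurable_funTS.
by apply: is_cvg_ereal_nneg_natsum => n _; exact: integral_ge0.
Qed.

HB.instance Definition _ x := isMeasure.Build _ _ _ (tilted_set x)
  (tilted0 x) (tilted_ge0 x) (@tilted_sigma_additive x).

Definition tilted (x : X) : {measure set (weight_space W) -> \bar R} :=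
  tilted_set x.

Let measurable_tilted A : measurable A ->
  measurable_fun [set: X] (tilted ^~ A).
Proof.
move=> mA; rewrite (_ : tilted ^~ A = fun x =>
    \int[Q x]_w ((fun w => (weight w)%:E) \_ A) w); last first.
  by apply/funext => x; rewrite /tilted /= /tilted_set integral_mkcond.
apply: measurable_fun_integral_kernel.
- by move=> B mB; exact: measurable_kernel.
- by apply: erestrict_ge0 => w _; exact: w_ge0.
- by apply/(measurable_restrictT _ _).1 => //; exact: measurable_funTS.
Qed.

HB.instance Definition _ := isKernel.Build _ _ _ _ _ tilted measurable_tilted.

Let tiltedT x : tilted x setT = 1.
Proof. exact: weight_mean1. Qed.

HB.instance Definition _ := Kernel_isProbability.Build _ _ _ _ _ tilted tiltedT.

End tilted.

Lemma measurable_invr (R : realType) :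
  measurable_fun [set: R] (@GRing.inv R).
Proof.
rewrite -(setvU [set 0%R]) (measurable_funU _ (measurableC _)) //; split.
  apply: open_continuous_measurable_fun.
    by apply: closed_openC; exact: closed_eq.
  by move=> x; rewrite inE => /eqP x0; exact: inv_continuous.
exact: measurable_fun_set1.
Qed.

Section pseudo_marginal.
Context d (X : measurableType d) (R : realType).
Variables (pi : probability X R) (q : R.-pker X ~> X).
Variables (W : nneg_borel R) (Q : weight_kernel X W) (r : tierney_ratio pi q).

Definition pm_target : probability (X * weight_space W)%type R :=
  semidirect pi (tilted Q).

(* min(1, r(x,y) u / w), read as 1 at w = 0 *)
Definition pm_acceptance
    (z : ((X * weight_space W) * (X * weight_space W))%type) : R :=
  (let: ((x, w), (y, u)) := z in
   if weight w == 0 then 1 else Num.min 1 (r (x, y) * (weight u / weight w)))%R.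

Lemma pm_acceptance01 z : (0 <= pm_acceptance z <= 1)%R.
Proof.
case: z => -[x w] [y u]; rewrite /pm_acceptance.
case: ifPn => _; first by rewrite ler01 lexx.
rewrite ge_min lexx andbT le_min ler01/= mulr_ge0 ?tierney_ratio_ge0//.
by rewrite divr_ge0 ?weight_ge0.
Qed.

Lemma measurable_pm_acceptance : measurable_fun setT pm_acceptance.
Proof.
pose S := (X * weight_space W)%type.
have mw (f : S * S -> weight_space W) : measurable_fun setT f ->
    measurable_fun setT (fun z => weight (f z)).
  by move=> mf; apply: measurableT_comp => //; exact: measurable_weight.
have m1 : measurable_fun setT (fun z : S * S => z.1.2).
  exact: (measurableT_comp measurable_snd).
have m2 : measurable_fun setT (fun z : S * S => z.2.2).
  exact: (measurableT_comp measurable_snd).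
rewrite (_ : pm_acceptance = fun z => if weight z.1.2 == 0%R then 1%R else
  (Num.min 1 (r (z.1.1, z.2.1) * (weight z.2.2 / weight z.1.2)))%R); last first.
  by apply/funext => -[[x w] [y u]].
apply: measurable_fun_ifT => //.
  by apply: measurable_fun_eqr => //; exact: mw.
apply: measurable_minr => //; apply: measurable_funM.
  apply: measurableT_comp; first exact: measurable_ratio.
  by apply/measurable_fun_pair; apply: measurableT_comp.
apply: measurable_funM; first exact: mw.
by apply: (@measurableT_comp _ _ _ _ _ _ (@GRing.inv R)); [exact: measurable_invr|exact: mw].
Qed.

Definition pm_kernel :
    R.-pker (X * weight_space W)%type ~> (X * weight_space W)%type :=
  mh (lifted_proposal q Q) measurable_pm_acceptance pm_acceptance01.

End pseudo_marginal.

(* Lebesgue measure on R^n, carried by n.-tuple R with its product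
   sigma-algebra: the image of lambda_1 x lambda_n under (x, t) |-> x :: t. *)
Section lebesgue_tuple.
Variable R : realType.

Definition cons_pair n (p : measurableTypeR R * n.-tuple R) : n.+1.-tuple R :=
  [tuple of p.1 :: p.2].

Lemma measurable_cons_pair n :
  measurable_fun [set: measurableTypeR R * n.-tuple R] (@cons_pair n).
Proof. exact: measurable_cons. Qed.

Section step.
Variables (n : nat) (mu : {sigma_finite_measure set (n.-tuple R) -> \bar R}).

Definition lebesgue_cons : set (n.+1.-tuple R) -> \bar R :=
  pushforward (@lebesgue_measure R \x mu) (@cons_pair n).

Let mpre A : measurable A -> measurable (@cons_pair n @^-1` A).
Proof. by move=> mA; rewrite -[X in measurable X]setTI; exact: measurable_cons_pair. Qed.

Let lc0 : lebesgue_cons set0 = 0.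
Proof. by rewrite /lebesgue_cons /pushforward preimage_set0 measure0. Qed.

Let lc_ge0 A : 0 <= lebesgue_cons A.
Proof. by rewrite /lebesgue_cons /pushforward. Qed.

Let lc_sigma_additive : semi_sigma_additive lebesgue_cons.
Proof.
move=> F mF tF mUF; rewrite /lebesgue_cons /pushforward preimage_bigcup.
apply: measure_semi_sigma_additive.
- by move=> k; exact: mpre.
- apply/trivIsetP => /= i j _ _ ij; rewrite -preimage_setI.
  by move/trivIsetP : tF => /(_ _ _ _ _ ij) ->//; rewrite preimage_set0.
- by rewrite -preimage_bigcup; exact: mpre.
Qed.

HB.instance Definition _ := isMeasure.Build _ _ _ lebesgue_cons
  lc0 lc_ge0 lc_sigma_additive.

Let lc_sigma_finite : sigma_finite setT lebesgue_cons.
Proof.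
have /sigma_finiteP[F [TF ndF Foo]] := sigma_finiteT (@lebesgue_measure R).
have /sigma_finiteP[G [TG ndG Goo]] := sigma_finiteT mu.
pose tl (t : n.+1.-tuple R) : n.-tuple R := [tuple of behead t].
have tlK x t : tl (cons_pair (x, t)) = t by exact/val_inj.
pose E k : set (n.+1.-tuple R) :=
  (fun t : n.+1.-tuple R => thead t) @^-1` F k `&` tl @^-1` G k.
have EE k : @cons_pair n @^-1` E k = F k `*` G k.
  by apply/seteqP; split => -[x t]; rewrite /E /= tlK theadE.
exists E.
  rewrite predeqE => t; split => // _.
  have [i _ Fi] : (\bigcup_i F i) (thead t) by rewrite -TF.
  have [j _ Gj] : (\bigcup_i G i) (tl t) by rewrite -TG.
  exists (maxn i j) => //; split.
    by have /subsetPset := ndF _ _ (leq_maxl i j); exact.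
  by have /subsetPset := ndG _ _ (leq_maxr i j); exact.
move=> k; have [mF lF] := Foo k; have [mG lG] := Goo k; split.
  apply: measurableI; rewrite -[X in measurable X]setTI.
    exact: (@measurable_tnth _ R).
  exact: measurable_behead.
rewrite /lebesgue_cons /pushforward EE product_measure1E//.
by rewrite lte_mul_pinfty// ge0_fin_numE.
Qed.

HB.instance Definition _ := Measure_isSigmaFinite.Build _ _ _ lebesgue_cons
  lc_sigma_finite.

End step.

Fixpoint lebesgue_tuple n : {sigma_finite_measure set (n.-tuple R) -> \bar R} :=
  match n with
  | 0 => \d_([tuple] : 0.-tuple R)
  | m.+1 => lebesgue_cons (lebesgue_tuple m)
  end.

Lemma lebesgue_tuple_box n (A : 'I_n -> set R) :
  (forall i, measurable (A i)) ->
  lebesgue_tuple n [set t | forall i, A i (tnth t i)] =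
  \prod_(i < n) lebesgue_measure (A i).
Proof.
elim: n A => [|n IHn] A mA.
  rewrite big_ord0 /= diracE mem_set// => -[]//.
rewrite big_ord_recl -(IHn (fun i => A (lift ord0 i)))// -product_measure1E//.
  rewrite /= /lebesgue_cons /pushforward; congr (_ _).
  apply/seteqP; split => -[x t] /=.
    move=> H; split; first exact: (H ord0).
    by move=> i; have := H (lift ord0 i); rewrite tnthS.
  by move=> [Ax At] i; case: (unliftP ord0 i) => [j ->|->]//; rewrite tnthS.
- exact: mA.
- rewrite (_ : [set t | _] = \bigcap_(i in [set: 'I_n])
    ((fun t : n.-tuple R => tnth t i) @^-1` A (lift ord0 i))); last first.
    by apply/seteqP; split => t /= At i; [move=> _; exact: At|exact: (At i)].
  apply: fin_bigcap_measurable => // i _.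
  by rewrite -[X in measurable X]setTI; exact: (@measurable_tnth _ R).
Qed.

End lebesgue_tuple.

Definition tuple_sub (R : realType) n (y x : n.-tuple R) : n.-tuple R :=
  [tuple (tnth y i - tnth x i)%R | i < n].

Definition tuple_opp (R : realType) n (x : n.-tuple R) : n.-tuple R :=
  [tuple (- tnth x i)%R | i < n].

Section l2.
Context d (T : measurableType d) (R : realType).
Variables (mu : probability T R) (P : R.-pker T ~> T).

(* <f, P f>_mu, where P f(s) = \int f(t) P(s, dt) *)
Definition quadratic_form (f : T -> R) : \bar R :=
  \int[mu]_s ((f s)%:E * \int[P s]_t (f t)%:E).

Definition positive_operator : Prop :=
  forall f : T -> R, measurable_fun setT f ->
    \int[mu]_s ((f s) ^+ 2)%:E < +oo -> 0 <= quadratic_form f.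

(* The infimum over the empty set is +oo. *)
Definition left_gap : \bar R := 1 + ereal_inf [set quadratic_form g | g in
  [set g : T -> R | [/\ measurable_fun setT g,
    \int[mu]_s (g s)%:E = 0 & \int[mu]_s ((g s) ^+ 2)%:E = 1]]].

End l2.

(* q(x, dy) = q0(dy) for all x, with pi << q0 *)
Definition is_imh d (X : measurableType d) (R : realType)
    (pi : probability X R) (q : R.-pker X ~> X) : Prop :=
  exists q0 : probability X R,
    (forall x A, measurable A -> q x A = q0 A) /\ pi `<< q0.

Definition is_density (R : realType) n (mu : set (n.-tuple R) -> \bar R)
    (p : n.-tuple R -> R) : Prop :=
  [/\ measurable_fun setT p, forall x, (0 <= p x)%R & forall A, measurable A ->
      mu A = \int[lebesgue_tuple R n]_(x in A) (p x)%:E].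

(* pi has a Lebesgue density and q(x, dy) = qt(y - x) dy for the symmetric
   probability density qt. *)
Definition is_rwm (R : realType) n (pi : probability (n.-tuple R) R)
    (q : R.-pker (n.-tuple R) ~> (n.-tuple R)) (qt : n.-tuple R -> R) : Prop :=
  [/\ exists p, is_density pi p,
      forall v, qt (tuple_opp v) = qt v,
      \int[lebesgue_tuple R n]_v (qt v)%:E = 1,
      measurable_fun setT qt &
      forall x, is_density (q x) (fun y => qt (tuple_sub y x))].

(* Main.v *)
Require Import Defs.
From HB Require Import structures.
From mathcomp Require Import all_boot all_order all_algebra finmap.
From mathcomp Require Import all_classical all_reals all_analysis.
From mathcomp Require Import measurable_realfun ring lra.

Set Implicit Arguments.
Unset Strict Implicit.
Unset Printing Implicit Defensive.

Import Order.TTheory GRing.Theory Num.Theory.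
Import numFieldNormedType.Exports.
Local Open Scope classical_set_scope.
Local Open Scope ring_scope.
Local Open Scope ereal_scope.

(** The form <f, P f> of a Metropolis-Hastings kernel P with target mu, proposal
K and acceptance probability a splits into the contribution of the accepted
moves and that of the rejections,
<<
  iint f(s) f(t) a(s,t) mu(ds) K(s,dt) + int f(s)^2 rejection(s) mu(ds).
>>
The second term is nonnegative, so positivity holds as soon as the flow
a(s,t) mu(ds) K(s,dt) has a positive semidefinite density with respect to some
m x m ([mh_positive_operator]).

For the pseudo-marginal kernel, let lambda be the reference measure on X (the
proposal q itself for the independent sampler, Lebesgue measure for the random
walk), p the density of pi and k(x,y) the density of q(x,dy), and take
m(dx,dw) = lambda(dx) Q_x(dw).  In either case k is symmetric, and Tierney's
ratio satisfies r(x,y) = p(y)/p(x) wherever this matters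
([tierney_ratio_minE]).  Hence the flow between s = (x,w) and t = (y,u) has
density ([acceptance_flowE])
<<
  w p(x) k(x,y) min(1, (p(y) u) / (p(x) w)) = min(w p(x), u p(y)) k(x,y).
>>
Both factors are Gram kernels: min(a,b) is the Lebesgue measure of the
intersection of [0,a) and [0,b), and k(x,y) = int eta(z,x) eta(z,y) nu(dz) by
assumption (with eta = 1 for the independent sampler).  Their product is then
the Gram kernel of the product features 1_{0 <= tau < w p(x)} eta(z,x)
([min_gramE]), and Fubini turns the form of a Gram kernel into the integral of
a square ([gram_integral_ge0]).  Fubini requires integrability of the features
with their signs removed, which can fail; it is restored by truncating to sets
of finite measure on which the diagonal of the kernel is bounded, and dominated
convergence removes the truncation.

Positivity bounds the infimum in the left gap below by 0, so the gap is at
least 1. *)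

(** * Integration against composite measures *)

Section nonneg_functional.
Context d (T : measurableType d) (R : realType).
Variables (mu : {measure set T -> \bar R}) (L : (T -> \bar R) -> \bar R).

Import HBNNSimple.

(** The standard machine, stated once: a functional on nonnegative functions
that is linear, continuous along nondecreasing sequences and agrees with mu on
indicators is the integral.  Its uses below compute integrals against measures
that are only known through their values on sets. *)
Lemma ge0_integral_functionalE :
  (forall A, measurable A -> L (fun t => (\1_A t)%:E) = mu A) ->
  (forall (c : R) f, (0 <= c)%R -> (forall t, 0 <= f t) ->
    measurable_fun setT f -> L (fun t => c%:E * f t) = c%:E * L f) ->
  (forall f g, (forall t, 0 <= f t) -> (forall t, 0 <= g t) ->
    measurable_fun setT f -> measurable_fun setT g ->
    L (fun t => f t + g t) = L f + L g) ->
  (forall (u : (T -> \bar R)^nat) f, (forall n t, 0 <= u n t) ->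
    (forall n, measurable_fun setT (u n)) ->
    (forall t, {homo u ^~ t : n k / (n <= k)%N >-> n <= k}) ->
    (forall t, u ^~ t @ \oo --> f t) -> L (u n) @[n --> \oo] --> L f) ->
  forall f, (forall t, 0 <= f t) -> measurable_fun setT f ->
    \int[mu]_t f t = L f.
Proof.
move=> Lind Lscale Ladd Lmono f f0 mf.
have L0 : L (cst 0) = 0.
  have -> : cst 0 = (fun t => (\1_(set0 : set T) t)%:E) :> (T -> \bar R).
    by apply/funext => t; rewrite indic0.
  by rewrite Lind ?measure0.
have Lsum (I : Type) (s : seq I) (F : I -> T -> \bar R) :
    (forall i t, 0 <= F i t) -> (forall i, measurable_fun setT (F i)) ->
    L (fun t => \sum_(i <- s) F i t) = \sum_(i <- s) L (F i).
  move=> F0 mF; elim: s => [|i s IH].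
    rewrite big_nil -[RHS]L0; congr L; apply/funext => t.
    by rewrite big_nil.
  rewrite big_cons -IH -Ladd//; last 2 first.
  - by move=> t; exact: sume_ge0.
  - exact: emeasurable_sum.
  by congr L; apply/funext => t; rewrite big_cons.
have Lsimple (h : {nnsfun T >-> R}) :
    \int[mu]_t (h t)%:E = L (fun t => (h t)%:E).
  (* [Num.max y 0] is y on the range of h; it makes every coefficient
     nonnegative without reference to membership in that range. *)
  have -> : (fun t => (h t)%:E) = (fun t =>
      \sum_(y <- fset_set (range h))
        (Num.max y 0)%:E * (\1_(h @^-1` [set y]) t)%:E).
    apply/funext => t; rewrite fimfunE -fsumEFin// fsbig_finite//=.
    apply: eq_big_seq => y; rewrite in_fset_set// inE => -[s _ <-].
    by rewrite max_l// EFinM.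
  have mi (y : R) :
      measurable_fun setT (fun t => (\1_(h @^-1` [set y]) t)%:E : \bar R).
    by apply/measurable_EFinP; exact: measurable_indic.
  have y0 (y : R) : (0 <= Num.max y 0)%R by rewrite le_max lexx orbT.
  rewrite ge0_integral_sum//; last 2 first.
  - by move=> y; apply: measurable_funeM.
  - by move=> y t _; rewrite mule_ge0// lee_fin.
  rewrite Lsum//; last 2 first.
  - by move=> y t; rewrite mule_ge0// lee_fin.
  - by move=> y; exact: measurable_funeM.
  apply: eq_bigr => y _; rewrite ge0_integralZl ?lee_fin//.
  by rewrite integral_indic// setIT Lscale// Lind.
pose f_ := nnsfun_approx measurableT mf.
have cvgf t : (f_ n t)%:E @[n --> \oo] --> f t by exact: cvg_nnsfun_approx.
have ndf t : {homo (fun n => (f_ n t)%:E) : n k / (n <= k)%N >-> n <= k}.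
  by move=> a b ab; rewrite lee_fin; exact/lefP/nd_nnsfun_approx.
have mf_ n : measurable_fun setT (fun t => (f_ n t)%:E).
  exact/measurable_EFinP.
have f_0 n t : 0 <= (f_ n t)%:E by rewrite lee_fin.
have H1 := Lmono (fun n t => (f_ n t)%:E) f f_0 mf_ ndf cvgf.
have H2 : \int[mu]_t (f_ n t)%:E @[n --> \oo] --> \int[mu]_t f t.
  have -> : \int[mu]_t f t = \int[mu]_t lim ((f_ n t)%:E @[n --> \oo]).
    by apply: eq_integral => t _; exact/esym/cvg_lim.
  exact: cvg_monotone_convergence.
rewrite -(cvg_lim _ H1)//; apply/esym/cvg_lim => //.
rewrite (_ : (fun n => L _) = fun n => \int[mu]_t (f_ n t)%:E)//.
by apply/funext => n; rewrite Lsimple.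
Qed.

End nonneg_functional.

Lemma ge0_integral_density d (T : measurableType d) (R : realType)
    (mu nu : {measure set T -> \bar R}) (h : T -> R) :
  measurable_fun setT h -> (forall t, (0 <= h t)%R) ->
  (forall A, measurable A -> nu A = \int[mu]_(t in A) (h t)%:E) ->
  forall f, (forall t, 0 <= f t) -> measurable_fun setT f ->
  \int[nu]_t f t = \int[mu]_t ((h t)%:E * f t).
Proof.
move=> mh0 h0 nuE f f0 mf.
have mh : measurable_fun setT (EFin \o h) by exact/measurable_EFinP.
have hge0 t : 0 <= (h t)%:E by rewrite lee_fin.
apply: (ge0_integral_functionalE
  (L := fun g => \int[mu]_t ((h t)%:E * g t))) => //.
- move=> A mA; rewrite nuE// [RHS]integral_mkcond.
  apply: eq_integral => t _; rewrite patchE indicE.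
  by case: ifP => _; rewrite ?mule1 ?mule0.
- move=> c g c0 g0 mg; rewrite -ge0_integralZl ?lee_fin//; last 2 first.
  - exact: emeasurable_funM.
  - by move=> t _; rewrite mule_ge0.
  by apply: eq_integral => t _; rewrite muleCA.
- move=> g k g0 k0 mg mk; rewrite -ge0_integralD//; last 4 first.
  - by move=> t _; rewrite mule_ge0.
  - exact: emeasurable_funM.
  - by move=> t _; rewrite mule_ge0.
  - exact: emeasurable_funM.
  by apply: eq_integral => t _; rewrite ge0_muleDr.
- move=> u g u0 mu_ ndu ug.
  have cvgu t : (h t)%:E * u n t @[n --> \oo] --> (h t)%:E * g t.
    exact: cvgeZl.
  have -> : \int[mu]_t ((h t)%:E * g t) =
      \int[mu]_t lim ((h t)%:E * u n t @[n --> \oo]).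
    by apply: eq_integral => t _; exact/esym/cvg_lim.
  apply: cvg_monotone_convergence => //.
  - by move=> n; exact: emeasurable_funM.
  - by move=> n t _; rewrite mule_ge0.
  - by move=> t _ a b ab; rewrite lee_wpmul2l// ndu.
Qed.

Section semidirect_integral.
Context d d' (X : measurableType d) (Y : measurableType d') (R : realType).
Variables (mu : {measure set X -> \bar R}) (K : R.-pker X ~> Y).

Lemma measurable_integral_section (f : X * Y -> \bar R) :
  (forall z, 0 <= f z) -> measurable_fun setT f ->
  measurable_fun setT (fun x => \int[K x]_y f (x, y)).
Proof. by move=> f0 mf; exact: measurable_fun_integral_finite_kernel. Qed.

Let mfst (f : X * Y -> \bar R) x : measurable_fun setT f ->
  measurable_fun setT (fun y => f (x, y)).
Proof. by move=> mf; exact: measurableT_comp. Qed.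

Lemma ge0_integral_semidirect (f : X * Y -> \bar R) :
  (forall z, 0 <= f z) -> measurable_fun setT f ->
  \int[semidirect mu K]_z f z = \int[mu]_x \int[K x]_y f (x, y).
Proof.
apply: (ge0_integral_functionalE
  (L := fun g => \int[mu]_x \int[K x]_y g (x, y))).
- move=> A mA; rewrite /= /semidirect; apply: eq_integral => x _.
  transitivity (\int[K x]_y (\1_(xsection A x) y)%:E).
    by apply: eq_integral => y _; rewrite !indicE mem_xsection.
  by rewrite integral_indic ?setIT//; exact: measurable_xsection.
- move=> c g c0 g0 mg; rewrite -ge0_integralZl ?lee_fin//; last 2 first.
  - exact: measurable_integral_section.
  - by move=> x _; exact: integral_ge0.
  by apply: eq_integral => x _; rewrite ge0_integralZl ?lee_fin//; exact: mfst.
- move=> g k g0 k0 mg mk; rewrite -ge0_integralD//; last 4 first.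
  - by move=> x _; exact: integral_ge0.
  - exact: measurable_integral_section.
  - by move=> x _; exact: integral_ge0.
  - exact: measurable_integral_section.
  by apply: eq_integral => x _; rewrite ge0_integralD//; exact: mfst.
- move=> u g u0 mu_ ndu ug.
  have cvgu x : \int[K x]_y u n (x, y) @[n --> \oo] --> \int[K x]_y g (x, y).
    have -> : \int[K x]_y g (x, y) = \int[K x]_y lim (u n (x, y) @[n --> \oo]).
      by apply: eq_integral => t _; exact/esym/cvg_lim.
    by apply: cvg_monotone_convergence => // n; exact: mfst.
  have -> : \int[mu]_x \int[K x]_y g (x, y) =
      \int[mu]_x lim (\int[K x]_y u n (x, y) @[n --> \oo]).
    by apply: eq_integral => t _; exact/esym/cvg_lim.
  apply: cvg_monotone_convergence => //.
  - by move=> n; exact: measurable_integral_section.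
  - by move=> n x _; exact: integral_ge0.
  - move=> x _ a b ab; apply: ge0_le_integral => //.
    + exact: mfst.
    + exact: mfst.
    + by move=> y _; exact: ndu.
Qed.

End semidirect_integral.

(** * Positivity of Gram kernels *)

Lemma ae_integral_ge0 d (T : measurableType d) (R : realType)
    (mu : {measure set T -> \bar R}) (h : T -> \bar R) :
  measurable_fun setT h -> {ae mu, forall t, 0 <= h t} ->
  0 <= \int[mu]_t h t.
Proof.
move=> mh h0; rewrite (ae_eq_integral (h^\+))//; last 2 first.
- exact: measurable_funepos.
- apply: filterS h0 => t ht _.
  by rewrite funeposE max_l.
by apply: integral_ge0 => t _; rewrite funepos_ge0.
Qed.

(** The double integral is the square of the integral of g.  Integrability of
the tensor square forces that of g, since otherwise the double integral of the
absolute value would be the square of an infinite one. *)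
Lemma integral_tensor_square_ge0 d (S : measurableType d) (R : realType)
    (m : {sigma_finite_measure set S -> \bar R}) (g : S -> R) :
  measurable_fun setT g ->
  (m \x m).-integrable setT (fun st => (g st.1 * g st.2)%:E) ->
  0 <= \int[m \x m]_st (g st.1 * g st.2)%:E.
Proof.
move=> mg ig.
have mEg : measurable_fun setT (EFin \o g) by exact/measurable_EFinP.
have gfin : m.-integrable setT (EFin \o g).
  apply/integrableP; split => //.
  have /(integrable12ltyP m m (measurable_int _ ig)).1 := ig.
  under eq_integral => s _.
    under eq_integral => t _ do rewrite /= normrM EFinM.
    rewrite /= ge0_integralZl//; last first.
      exact/measurable_EFinP/measurableT_comp.
    over.
  rewrite /= ge0_integralZr//; last 2 first.
  - exact/measurable_EFinP/measurableT_comp.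
  - exact: integral_ge0.
  have : 0 <= \int[m]_x `|(g x)%:E| by exact: integral_ge0.
  by case: (\int[m]_x `|(g x)%:E|) => [r _ _|//|//]; exact: ltry.
have gE : \int[m]_s (g s)%:E \is a fin_num by exact: integrable_fin_num.
rewrite -integral12_prod_meas1//= /fubini_F.
under eq_integral => s _.
  under eq_integral => t _ do rewrite /= EFinM.
  rewrite /= integralZl//.
  over.
rewrite /= -(fineK gE) integralZr//= -(fineK gE) -EFinM lee_fin.
by rewrite -expr2 sqr_ge0.
Qed.

(** Fubini's theorem is used below on products that have a product measure as
a factor, and it asks for sigma-finite factors. *)
Lemma sigma_finite_product_measure d1 d2 (T1 : measurableType d1)
    (T2 : measurableType d2) (R : realType)
    (m1 : {sigma_finite_measure set T1 -> \bar R})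
    (m2 : {sigma_finite_measure set T2 -> \bar R}) :
  sigma_finite setT (m1 \x m2).
Proof.
have /sigma_finiteP[F [TF ndF Foo]] := sigma_finiteT m1.
have /sigma_finiteP[G [TG ndG Goo]] := sigma_finiteT m2.
exists (fun n => F n `*` G n).
  rewrite predeqE => -[x y]; split => // _.
  have [i _ Fi] : (\bigcup_i F i) x by rewrite -TF.
  have [j _ Gj] : (\bigcup_i G i) y by rewrite -TG.
  exists (maxn i j) => //; split.
    by have /subsetPset := ndF _ _ (leq_maxl i j); exact.
  by have /subsetPset := ndG _ _ (leq_maxr i j); exact.
move=> k; have [mF lF] := Foo k; have [mG lG] := Goo k.
split; first exact: measurableX.
by rewrite product_measure1E// lte_mul_pinfty// ge0_fin_numE.
Qed.

Section gram.
Context dS dZ (S : measurableType dS) (Z : measurableType dZ) (R : realType).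
Variables (m : {sigma_finite_measure set S -> \bar R})
  (nu : {sigma_finite_measure set Z -> \bar R}).

Let measurable_row (phi : Z * S -> R) (z : Z) : measurable_fun setT phi ->
  measurable_fun setT (fun s => phi (z, s)).
Proof. by move=> mphi; exact: measurableT_comp. Qed.

Let measurable_col (phi : Z * S -> R) (s : S) : measurable_fun setT phi ->
  measurable_fun setT (fun z => phi (z, s)).
Proof. by move=> mphi; exact: measurableT_comp. Qed.

(** When the features vanish off a set of finite measure and the diagonal of G
is bounded, |phi(z,s) phi(z,t)| <= (phi(z,s)^2 + phi(z,t)^2) / 2 makes the
triple integrand absolutely integrable.  Integrating over (s,t) first then
leaves the integral over z of a square. *)
Lemma gram_bounded_integral_ge0 (phi : Z * S -> R) (G : S * S -> R)
    (E : set S) (C : R) :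
  measurable_fun setT phi ->
  (forall s t, (G (s, t))%:E = \int[nu]_z (phi (z, s) * phi (z, t))%:E) ->
  measurable E -> m E < +oo ->
  (forall z s, ~ E s -> phi (z, s) = 0%R) ->
  (forall s, (G (s, s) <= C)%R) -> (0 <= C)%R ->
  0 <= \int[m \x m]_st (G st)%:E.
Proof.
move=> mphi GE mE mEoo phiE GC C0.
pose F (x : (S * S) * Z) : R := (phi (x.2, x.1.1) * phi (x.2, x.1.2))%R.
have mF : measurable_fun setT (EFin \o F).
  apply/measurable_EFinP; apply: measurable_funM.
    apply: (measurableT_comp mphi); apply/measurable_fun_pair => //.
    exact: measurableT_comp.
  apply: (measurableT_comp mphi); apply/measurable_fun_pair => //.
  exact: measurableT_comp.
have Fbound s t :
    \int[nu]_z `|(F ((s, t), z))%:E| <= C%:E * (\1_E s * \1_E t)%:E.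
  have [Es|Es] := pselect (E s); last first.
    rewrite integral0_eq ?indicE ?(memNset Es)// ?mul0r ?mule0//.
    by move=> z _; rewrite /F /= phiE// mul0r normr0.
  have [Et|Et] := pselect (E t); last first.
    rewrite integral0_eq ?indicE ?(memNset Et)// ?mulr0 ?mule0//.
    by move=> z _; rewrite /F /= (phiE z t)// mulr0 normr0.
  rewrite !indicE !mem_set// mulr1 mule1.
  have sq_meas u : measurable_fun setT (fun z => (phi (z, u) * phi (z, u))%:E).
    by apply/measurable_EFinP; apply: measurable_funM; exact: measurable_col.
  apply: (@le_trans _ _ (\int[nu]_z ((2^-1)%:E *
      ((phi (z, s) * phi (z, s))%:E + (phi (z, t) * phi (z, t))%:E)))).
    apply: ge0_le_integral => //.
    - apply: measurableT_comp => //.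
      by apply: (measurableT_comp mF (pair1_measurable (s, t))).
    - by apply: measurable_funeM; exact: emeasurable_funD.
    - move=> z _; rewrite /F /= -EFinD -EFinM lee_fin normrM.
      have := sqr_ge0 (`|phi (z, s)| - `|phi (z, t)|)%R.
      rewrite -!expr2 -(real_normK (num_real (phi (z, s)))).
      by rewrite -(real_normK (num_real (phi (z, t)))); nra.
  have sq0 u z : 0 <= (phi (z, u) * phi (z, u))%:E.
    by rewrite lee_fin -expr2 sqr_ge0.
  rewrite ge0_integralZl//; last 2 first.
  - exact: emeasurable_funD.
  - by move=> z _; rewrite adde_ge0.
  rewrite ge0_integralD// -!GE -EFinD -EFinM lee_fin.
  have := GC s; have := GC t; lra.
pose sf := Measure_isSigmaFinite.Build _ _ _ (m \x m)%E
  (sigma_finite_product_measure m m).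
pose mm : {sigma_finite_measure set (S * S)%type -> \bar R} :=
  HB.pack (m \x m)%E sf.
have iF : (mm \x nu).-integrable setT (EFin \o F).
  apply/(integrable12ltyP mm nu mF).2.
  apply: (@le_lt_trans _ _
    (\int[m \x m]_st (C%:E * (\1_E st.1 * \1_E st.2)%:E))).
    apply: ge0_le_integral => //.
    - by move=> st _; exact: integral_ge0.
    - apply: (measurable_fun_fubini_tonelli_F (abse \o (EFin \o F))) => //=.
      exact: measurableT_comp.
    - apply: measurable_funeM; apply/measurable_EFinP; apply: measurable_funM.
        by apply: measurableT_comp.
      by apply: measurableT_comp.
    - by move=> [s t] _; exact: Fbound.
  rewrite (eq_integral (fun st => C%:E * (\1_(E `*` E) st)%:E)); last first.
    move=> [s t] _; congr (_ * _%:E); rewrite !indicE /=.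
    by rewrite in_setX /=; case: (s \in E); case: (t \in E);
      rewrite /= ?mulr1 ?mulr0.
  have mEE : measurable (E `*` E) by exact: measurableX.
  rewrite ge0_integralZl//; last first.
    by apply/measurable_EFinP; exact: measurable_indic.
  rewrite integral_indic// setIT.
  rewrite [X in _ * X](_ : _ = m E * m E); last exact: product_measure1E.
  by rewrite lte_mul_pinfty// lte_mul_pinfty// ge0_fin_numE.
rewrite (eq_integral (fubini_F nu (EFin \o F))); last first.
  by move=> [s t] _; rewrite GE.
rewrite [leRHS](integral12_prod_meas1 iF) -integral21_prod_meas1//.
apply: ae_integral_ge0.
  exact: (measurable_fubini_G iF).
apply: filterS (ae_integrable2 iF) => z iz.
exact: (integral_tensor_square_ge0 (g := fun s => phi (z, s))
  (measurable_row _ mphi)).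
Qed.

(** The products phi(z,s) phi(z,t) need not be jointly integrable in (s,t,z)
even though G is integrable, so Fubini does not apply directly.  Truncation to
the sets [E n] below makes [gram_bounded_integral_ge0] applicable, and |G|
dominates the truncated kernels. *)
Lemma gram_integral_ge0 (phi : Z * S -> R) (G : S * S -> R) :
  measurable_fun setT phi ->
  (forall s t, (G (s, t))%:E = \int[nu]_z (phi (z, s) * phi (z, t))%:E) ->
  (m \x m).-integrable setT (EFin \o G) ->
  0 <= \int[m \x m]_st (G st)%:E.
Proof.
move=> mphi GE iG.
have mG : measurable_fun setT G.
  by apply/measurable_EFinP; exact: measurable_int iG.
have /sigma_finiteP[F [TF ndF Foo]] := sigma_finiteT m.
pose diagG s := G (s, s).
have mdiagG : measurable_fun setT diagG.
  by apply: (measurableT_comp mG); apply/measurable_fun_pair.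
(* The truncation: finite measure, and diagonal bounded by n. *)
pose E n := F n `&` diagG @^-1` `]-oo, n%:R].
have mE n : measurable (E n).
  apply: measurableI; first by have [] := Foo n.
  by rewrite -[X in measurable X]setTI; exact: mdiagG.
pose G_ n (st : S * S) : R := (G st * (\1_(E n) st.1 * \1_(E n) st.2))%R.
have mG_ n : measurable_fun setT (G_ n).
  by apply: measurable_funM => //; apply: measurable_funM;
    exact: measurableT_comp.
have G_ge0 n : 0 <= \int[m \x m]_st (G_ n st)%:E.
  pose phi_ (zs : Z * S) : R := (phi zs * \1_(E n) zs.2)%R.
  apply: (@gram_bounded_integral_ge0 phi_ (G_ n) (E n) n%:R) => //.
  - by apply: measurable_funM => //; exact: measurableT_comp.
  - move=> s t; rewrite /G_ /phi_ /=.
    have [Es|Es] := boolP (s \in E n); last first.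
      rewrite !indicE (negbTE Es) mul0r mulr0 integral0_eq// => z _.
      by rewrite mulr0 mul0r.
    have [Et|Et] := boolP (t \in E n); last first.
      rewrite !indicE (negbTE Et) !mulr0 integral0_eq// => z _.
      by rewrite !mulr0.
    rewrite !indicE Es Et !mulr1 GE; apply: eq_integral => z _.
    by rewrite !mulr1.
  - have [mF Fn] := Foo n; apply: le_lt_trans Fn; apply: le_measure => //.
    + by rewrite inE.
    + by rewrite inE.
    + exact: subIsetl.
  - by move=> z s Es; rewrite /phi_ /= indicE memNset// mulr0.
  - move=> s; rewrite /G_ /= !indicE.
    have [|_] := boolP (s \in E n); last by rewrite !mulr0.
    by rewrite inE !mulr1 => -[_]; rewrite /= in_itv.
have cvgG : \int[m \x m]_st (G_ n st)%:E @[n --> \oo] -->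
    \int[m \x m]_st (G st)%:E.
  apply: (@dominated_cvg _ _ _ _ _ _ _ (EFin \o G)
    (fun st => `|G st|%:E)) => //.
  - by move=> n; exact/measurable_EFinP.
  - move=> [s t] _; apply: cvg_near_cst.
    have [i _ Fi] : (\bigcup_i F i) s by rewrite -TF.
    have [j _ Fj] : (\bigcup_i F i) t by rewrite -TF.
    near=> n.
    have Es : s \in E n.
      rewrite inE; split.
        have /subsetPset FF : (F i <= F n)%O.
          by apply: ndF; near: n; exact: nbhs_infty_ge.
        exact: FF.
      by rewrite /= in_itv /=; near: n; exact: nbhs_infty_ger.
    have Et : t \in E n.
      rewrite inE; split.
        have /subsetPset FF : (F j <= F n)%O.
          by apply: ndF; near: n; exact: nbhs_infty_ge.
        exact: FF.
      by rewrite /= in_itv /=; near: n; exact: nbhs_infty_ger.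
    by rewrite /G_ /= !indicE Es Et !mulr1.
  - exact: (integrable_abse iG).
  - move=> n [s t] _; rewrite lee_fin /G_ normrM ler_piMr//= !indicE.
    by case: (s \in E n); case: (t \in E n);
      rewrite ?mulr1 ?mulr0 ?normr1 ?normr0.
by apply: cvge_ge cvgG; exact: nearW.
Unshelve. all: by end_near.
Qed.

End gram.

(** * The quadratic form of a Metropolis-Hastings kernel *)

Section metropolis_hastings_form.
Context d (S : measurableType d) (R : realType).
Variables (mu : probability S R) (K : R.-pker S ~> S) (a : S * S -> R).
Hypotheses (ma : measurable_fun setT a) (a01 : forall z, (0 <= a z <= 1)%R).

Local Notation P := (mh K ma a01).

Let a_ge0 z : 0 <= (a z)%:E.
Proof. by rewrite lee_fin; case/andP: (a01 z). Qed.

Let mas s : measurable_fun setT (fun t => (a (s, t))%:E).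
Proof. by apply/measurable_EFinP; exact: (measurableT_comp ma). Qed.

Let msec (g : S * S -> \bar R) s : measurable_fun setT g ->
  measurable_fun setT (fun t => g (s, t)).
Proof. by move=> mg; exact: measurableT_comp. Qed.

Lemma rejection_le1 s : rejection K a s <= 1.
Proof. by rewrite /rejection geeDl// oppe_le0 integral_ge0. Qed.

Lemma ge0_integral_mh (s : S) (f : S -> \bar R) :
  (forall t, 0 <= f t) -> measurable_fun setT f ->
  \int[P s]_t f t =
  \int[K s]_t ((a (s, t))%:E * f t) + rejection K a s * f s.
Proof.
have rej0 : 0 <= rejection K a s by exact: rejection_ge0.
apply: (ge0_integral_functionalE
  (L := fun g => \int[K s]_t ((a (s, t))%:E * g t) + rejection K a s * g s)).
- move=> A mA; rewrite /= /mh_kernel [in RHS]integral_mkcond.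
  congr (_ + _ * _).
  apply: eq_integral => t _; rewrite patchE indicE.
  by case: ifP => _; rewrite ?mule1 ?mule0.
- move=> c g c0 g0 mg; rewrite ge0_muleDr; last 2 first.
  - by apply: integral_ge0 => t _; exact: mule_ge0.
  - exact: mule_ge0.
  rewrite -ge0_integralZl ?lee_fin//; last 2 first.
  - exact: emeasurable_funM.
  - by move=> t _; rewrite mule_ge0.
  congr (_ + _); last by rewrite muleCA.
  by apply: eq_integral => t _; rewrite muleCA.
- move=> g k g0 k0 mg mk; rewrite /= ge0_muleDr//.
  rewrite [RHS]addeACA -ge0_integralD//; last 4 first.
  - by move=> t _; rewrite mule_ge0.
  - exact: emeasurable_funM.
  - by move=> t _; rewrite mule_ge0.
  - exact: emeasurable_funM.
  by congr (_ + _); apply: eq_integral => t _; rewrite ge0_muleDr.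
- move=> u g u0 mu_ ndu ug.
  have g0 t : 0 <= g t by apply: cvge_ge (ug t); exact: nearW.
  apply: cvgeD.
  + by rewrite ge0_adde_def// inE ?mule_ge0//; apply: integral_ge0 => t _;
      exact: mule_ge0.
  + have cvgu t : (a (s, t))%:E * u n t @[n --> \oo] --> (a (s, t))%:E * g t.
      exact: cvgeZl.
    have -> : \int[K s]_t ((a (s, t))%:E * g t) =
        \int[K s]_t lim ((a (s, t))%:E * u n t @[n --> \oo]).
      by apply: eq_integral => t _; exact/esym/cvg_lim.
    apply: cvg_monotone_convergence => //.
    * by move=> n; exact: emeasurable_funM.
    * by move=> n t _; rewrite mule_ge0.
    * by move=> t _ b c bc; rewrite lee_wpmul2l// ndu.
  + apply: cvgeZl => //; rewrite ge0_fin_numE//.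
    by rewrite (le_lt_trans (rejection_le1 s))// ltry.
Qed.

Lemma measurable_rejection : measurable_fun setT (rejection K a).
Proof.
apply: emeasurable_funB => //.
by apply: (@measurable_integral_section _ _ _ _ _ K (EFin \o a)) => //;
  exact/measurable_EFinP.
Qed.

Lemma ge0_integral_mh2 (G : S * S -> \bar R) :
  (forall z, 0 <= G z) -> measurable_fun setT G ->
  \int[mu]_s \int[P s]_t G (s, t) =
  \int[mu]_s \int[K s]_t ((a (s, t))%:E * G (s, t)) +
  \int[mu]_s (rejection K a s * G (s, s)).
Proof.
move=> G0 mG; rewrite -ge0_integralD//; last 4 first.
- by move=> s _; apply: integral_ge0 => t _; exact: mule_ge0.
- apply: (@measurable_integral_section _ _ _ _ _ K (fun z => (a z)%:E * G z)).
    by move=> z; exact: mule_ge0.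
  by apply: emeasurable_funM => //; exact/measurable_EFinP.
- by move=> s _; rewrite mule_ge0// rejection_ge0.
- apply: emeasurable_funM; first exact: measurable_rejection.
  by apply: (measurableT_comp mG); exact/measurable_fun_pair.
apply: eq_integral => s _; rewrite ge0_integral_mh//; exact: msec.
Qed.

End metropolis_hastings_form.

Section metropolis_hastings_positive.
Context d (S : measurableType d) (R : realType).
Variables (mu : probability S R) (K : R.-pker S ~> S) (a : S * S -> R).
Hypotheses (ma : measurable_fun setT a) (a01 : forall z, (0 <= a z <= 1)%R).
Variables (m : {sigma_finite_measure set S -> \bar R}) (kappa : S * S -> R).
Hypotheses (mkappa : measurable_fun setT kappa)
  (kappa0 : forall z, (0 <= kappa z)%R).
Hypothesis kappaC : forall s t, kappa (s, t) = kappa (t, s).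
Hypothesis kappaE : forall G : S * S -> \bar R, (forall z, 0 <= G z) ->
  measurable_fun setT G ->
  \int[mu]_s \int[K s]_t ((a (s, t))%:E * G (s, t)) =
  \int[m \x m]_z ((kappa z)%:E * G z).

Local Notation P := (mh K ma a01).

Let mEkappa : measurable_fun setT (EFin \o kappa).
Proof. exact/measurable_EFinP. Qed.

Let kappa_ge0 z : 0 <= (kappa z)%:E. Proof. by rewrite lee_fin. Qed.

(** The accepted flow out of s has total mass at most 1, and by symmetry of
kappa the same bound holds for the flow into t ([integral_kappa_snd]). *)
Let integral_kappa_fst_le (g : S -> \bar R) :
  (forall s, 0 <= g s) -> measurable_fun setT g ->
  \int[m \x m]_z ((kappa z)%:E * g z.1) <= \int[mu]_s g s.
Proof.
move=> g0 mg; rewrite -kappaE//=; last exact: measurableT_comp.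
have mas s : measurable_fun setT (fun t => (a (s, t))%:E).
  by apply/measurable_EFinP; exact: (measurableT_comp ma).
have a_ge0 z : 0 <= (a z)%:E by rewrite lee_fin; case/andP: (a01 z).
apply: ge0_le_integral => //.
- by move=> s _; apply: integral_ge0 => t _; exact: mule_ge0.
- apply: (@measurable_integral_section _ _ _ _ _ K (fun z => (a z)%:E * g z.1)).
    by move=> z; exact: mule_ge0.
  by apply: emeasurable_funM; [exact/measurable_EFinP|exact: measurableT_comp].
- move=> s _; apply: (@le_trans _ _ (\int[K s]_t (cst (g s) t))).
    apply: ge0_le_integral => //.
    + by move=> t _; exact: mule_ge0.
    + exact: emeasurable_funM.
    + move=> t _; rewrite /= -[leRHS]mul1e lee_wpmul2r// lee_fin.
      by case/andP: (a01 (s, t)).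
  by rewrite integral_cst// prob_kernel mule1.
Qed.

Let integral_kappa_snd (g : S -> \bar R) :
  (forall s, 0 <= g s) -> measurable_fun setT g ->
  \int[m \x m]_z ((kappa z)%:E * g z.2) = \int[m \x m]_z ((kappa z)%:E * g z.1).
Proof.
move=> g0 mg.
rewrite fubini_tonelli1; last 2 first.
- apply: emeasurable_funM => //; exact: measurableT_comp.
- by move=> z; exact: mule_ge0.
rewrite fubini_tonelli2; last 2 first.
- apply: emeasurable_funM => //; exact: measurableT_comp.
- by move=> z; exact: mule_ge0.
apply: eq_integral => s _; apply: eq_integral => t _ /=.
by rewrite kappaC.
Qed.

Let mh_integral (G : S * S -> \bar R) : (forall z, 0 <= G z) ->
  measurable_fun setT G ->
  \int[mu]_s \int[P s]_t G (s, t) = \int[m \x m]_z ((kappa z)%:E * G z) +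
    \int[mu]_s (rejection K a s * G (s, s)).
Proof. by move=> G0 mG; rewrite ge0_integral_mh2// kappaE. Qed.

Section test_function.
Variable f : S -> R.
Hypotheses (mf : measurable_fun setT f) (f2 : \int[mu]_s ((f s) ^+ 2)%:E < +oo).

Let h (z : S * S) : \bar R := (f z.1 * f z.2)%:E.

Let measurable_h : measurable_fun setT h.
Proof.
apply/measurable_EFinP; apply: measurable_funM; exact: measurableT_comp.
Qed.

Let mf2 : measurable_fun setT (fun s => ((f s) ^+ 2)%:E).
Proof. by apply/measurable_EFinP; exact: measurable_funX. Qed.

Let f2_ge0 s : 0 <= ((f s) ^+ 2)%:E.
Proof. by rewrite lee_fin sqr_ge0. Qed.

(** From |f(s) f(t)| <= f(s)^2 + f(t)^2 and the two marginal bounds. *)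
Lemma kappa_integrable :
  (m \x m).-integrable setT (fun z => (kappa z * (f z.1 * f z.2))%:E).
Proof.
apply/integrableP; split.
  apply/measurable_EFinP; apply: measurable_funM => //; exact/measurable_EFinP.
pose g z := (kappa z)%:E * ((f z.1) ^+ 2)%:E + (kappa z)%:E * ((f z.2) ^+ 2)%:E.
have mg1 : measurable_fun setT (fun z => (kappa z)%:E * ((f z.1) ^+ 2)%:E).
  apply: emeasurable_funM => //.
  exact: (measurableT_comp mf2 measurable_fst).
have mg2 : measurable_fun setT (fun z => (kappa z)%:E * ((f z.2) ^+ 2)%:E).
  apply: emeasurable_funM => //.
  exact: (measurableT_comp mf2 measurable_snd).
apply: (@le_lt_trans _ _ (\int[m \x m]_z g z)).
  apply: ge0_le_integral => //.
  - apply: measurableT_comp => //; apply/measurable_EFinP.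
    apply: measurable_funM => //; exact/measurable_EFinP.
  - exact: emeasurable_funD.
  - move=> z _; rewrite /g -!EFinM -EFinD lee_fin normrM (ger0_norm (kappa0 z)).
    rewrite -mulrDr ler_wpM2l// normrM.
    rewrite -(real_normK (num_real (f z.1))) -(real_normK (num_real (f z.2))).
    have := normr_ge0 (f z.1); have := normr_ge0 (f z.2); nra.
rewrite ge0_integralD//; last 2 first.
- by move=> z _; exact: mule_ge0.
- by move=> z _; exact: mule_ge0.
rewrite (integral_kappa_snd (g := fun s => (f s ^+ 2)%:E))//.
have := integral_kappa_fst_le f2_ge0 mf2.
by move=> H; apply: lte_add_pinfty; apply: le_lt_trans H f2.
Qed.

Lemma integral_rejection_lty :
  \int[mu]_s (rejection K a s * ((f s) ^+ 2)%:E) < +oo.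
Proof.
apply: le_lt_trans f2; apply: ge0_le_integral => //.
- by move=> s _; rewrite mule_ge0// rejection_ge0.
- by apply: emeasurable_funM => //; exact: measurable_rejection.
- by move=> s _; rewrite -[leRHS]mul1e lee_wpmul2r// rejection_le1.
Qed.

Let mhp : measurable_fun setT h^\+. Proof. exact: measurable_funepos. Qed.
Let mhn : measurable_fun setT h^\-. Proof. exact: measurable_funeneg. Qed.

Let kappa_h z : (kappa z * (f z.1 * f z.2))%:E = (kappa z)%:E * h z.
Proof. by rewrite EFinM. Qed.

Let ih : (m \x m).-integrable setT (fun z => (kappa z)%:E * h z).
Proof.
rewrite (_ : (fun z => _) = fun z => (kappa z * (f z.1 * f z.2))%:E).
  exact: kappa_integrable.
by apply/funext => z; rewrite kappa_h.
Qed.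

Let kappa_hp : \int[m \x m]_z ((kappa z)%:E * h^\+ z) =
  \int[m \x m]_z (fun z => (kappa z)%:E * h z)^\+ z.
Proof.
apply: eq_integral => z _; rewrite !funeposE /h -EFinM -!EFin_max -EFinM.
by rewrite maxr_pMr// mulr0.
Qed.

Let kappa_hn : \int[m \x m]_z ((kappa z)%:E * h^\- z) =
  \int[m \x m]_z (fun z => (kappa z)%:E * h z)^\- z.
Proof.
have maxN (x : R) : maxe (- x%:E) 0 = (Num.max (- x) 0)%:E by rewrite EFin_max.
apply: eq_integral => z _; rewrite !funenegE /h -EFinM [RHS]maxN -mulrN.
rewrite [X in _ * X = _]maxN -EFinM; congr EFin.
by rewrite maxr_pMr// mulr0.
Qed.

Let rej_hp : \int[mu]_s (rejection K a s * h^\+ (s, s)) =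
  \int[mu]_s (rejection K a s * ((f s) ^+ 2)%:E).
Proof.
apply: eq_integral => s _; rewrite funeposE /h /= max_l// lee_fin.
by rewrite -expr2 sqr_ge0.
Qed.

Let rej_hn : \int[mu]_s (rejection K a s * h^\- (s, s)) = 0.
Proof.
apply: integral0_eq => s _; rewrite funenegE /h /= max_r ?mule0//.
by rewrite lee_fin oppr_le0 -expr2 sqr_ge0.
Qed.

Let hp_int := integrable_pos_fin_num measurableT ih.
Let hn_int := integrable_neg_fin_num measurableT ih.

Let rej_fin : \int[mu]_s (rejection K a s * ((f s) ^+ 2)%:E) \is a fin_num.
Proof.
rewrite ge0_fin_numE; first exact: integral_rejection_lty.
by apply: integral_ge0 => s _; rewrite mule_ge0// rejection_ge0.
Qed.

Let mh_integral_hp : \int[mu]_s \int[P s]_t h^\+ (s, t) =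
  \int[m \x m]_z (fun z => (kappa z)%:E * h z)^\+ z +
  \int[mu]_s (rejection K a s * ((f s) ^+ 2)%:E).
Proof. by rewrite mh_integral// kappa_hp rej_hp. Qed.

Let mh_integral_hn : \int[mu]_s \int[P s]_t h^\- (s, t) =
  \int[m \x m]_z (fun z => (kappa z)%:E * h z)^\- z.
Proof. by rewrite mh_integral// kappa_hn rej_hn adde0. Qed.

Let integrable_section (g : S * S -> \bar R) : (forall z, 0 <= g z) ->
  measurable_fun setT g -> \int[mu]_s \int[P s]_t g (s, t) \is a fin_num ->
  mu.-integrable setT (fun s => \int[P s]_t g (s, t)).
Proof.
move=> g0 mg goo; apply/integrableP; split.
  exact: measurable_integral_section.
under eq_integral => s _ do rewrite gee0_abs ?integral_ge0//.
by rewrite -ge0_fin_numE// integral_ge0// => s _; exact: integral_ge0.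
Qed.

Let ihp : mu.-integrable setT (fun s => \int[P s]_t h^\+ (s, t)).
Proof.
by apply: integrable_section => //; rewrite mh_integral_hp fin_numD hp_int.
Qed.

Let ihn : mu.-integrable setT (fun s => \int[P s]_t h^\- (s, t)).
Proof. by apply: integrable_section => //; rewrite mh_integral_hn. Qed.

Let section_mh s : measurable_fun setT (fun t => h (s, t)).
Proof. exact: measurableT_comp. Qed.

Let integral_sectionE s : \int[P s]_t h (s, t) =
  \int[P s]_t h^\+ (s, t) - \int[P s]_t h^\- (s, t).
Proof. by rewrite integralE (funepos_comp h) (funeneg_comp h). Qed.

Let mPf : measurable_fun setT (fun s => \int[P s]_t (f t)%:E).
Proof.
rewrite [X in measurable_fun _ X](_ : _ = fun s =>
    \int[P s]_t (EFin \o f)^\+ t - \int[P s]_t (EFin \o f)^\- t); last first.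
  by apply/funext => s; exact: integralE.
have mEf : measurable_fun setT (EFin \o f) by exact/measurable_EFinP.
apply: emeasurable_funB.
  apply: (@measurable_integral_section _ _ _ _ _ P
    (fun z => (EFin \o f)^\+ z.2)) => //.
  exact: (measurableT_comp (measurable_funepos mEf) measurable_snd).
apply: (@measurable_integral_section _ _ _ _ _ P
  (fun z => (EFin \o f)^\- z.2)) => //.
exact: (measurableT_comp (measurable_funeneg mEf) measurable_snd).
Qed.

(** The inner integral of f against P need only make sense for almost every s,
so the form is first rewritten as an integral of f(s) f(t), then split into its
positive and negative parts, for which the identity is Tonelli's theorem.  On
the diagonal f(s) f(s) is nonnegative, so the rejections only enter the
positive part. *)
Lemma quadratic_form_mh : quadratic_form mu P f =
  \int[m \x m]_z (kappa z * (f z.1 * f z.2))%:E +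
  \int[mu]_s (rejection K a s * ((f s) ^+ 2)%:E).
Proof.
transitivity (\int[mu]_s \int[P s]_t h (s, t)).
  apply: ae_eq_integral => //.
  - by apply: emeasurable_funM => //; exact/measurable_EFinP.
  - under [X in measurable_fun _ X]eq_fun do rewrite integral_sectionE.
    by apply: emeasurable_funB; exact: measurable_integral_section.
  - have := integrable_ae measurableT (integrableD measurableT ihp ihn).
    apply: filterS => s /(_ I) /= hfin _.
    have hs : (P s).-integrable setT (fun t => h (s, t)).
      apply/integrableP; split => //.
      rewrite (eq_integral (fun t => h^\+ (s, t) + h^\- (s, t))); last first.
        by move=> t _; rewrite -[RHS]/((h^\+ \+ h^\-) (s, t)) -fune_abse.
      rewrite ge0_integralD//; last 2 first.
      + exact: (measurableT_comp mhp).
      + exact: (measurableT_comp mhn).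
      by rewrite -ge0_fin_numE// adde_ge0// integral_ge0.
    (* Integrability of f s * f t in t gives that of f only when f s is
       nonzero; both sides vanish otherwise. *)
    have [fs0|fs0] := eqVneq (f s) 0%R.
      rewrite fs0 mul0e; apply/esym/integral0_eq => t _.
      by rewrite /h /= fs0 mul0r.
    have fint : (P s).-integrable setT (EFin \o f).
      rewrite (_ : EFin \o f = fun t => ((f s)^-1)%:E * h (s, t)).
        exact: integrableZl.
      by apply/funext => t; rewrite /h /= -EFinM mulKf.
    by rewrite -integralZl//; apply: eq_integral => t _; rewrite /h EFinM.
under eq_integral => s _ do rewrite integral_sectionE.
rewrite integralB// mh_integral_hp mh_integral_hn.
rewrite [X in _ = X + _](_ : _ =
    \int[m \x m]_z ((kappa z)%:E * h z)); last first.
  by apply: eq_integral => z _; exact: kappa_h.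
by rewrite [X in _ = X + _]integralE addeAC.
Qed.

End test_function.

Lemma mh_positive_operator :
  (forall f : S -> R, measurable_fun setT f ->
    (m \x m).-integrable setT (fun z => (kappa z * (f z.1 * f z.2))%:E) ->
    0 <= \int[m \x m]_z (kappa z * (f z.1 * f z.2))%:E) ->
  positive_operator mu P.
Proof.
move=> kappa_pos f mf f2; rewrite quadratic_form_mh// adde_ge0//.
  by apply: kappa_pos => //; exact: kappa_integrable.
apply: integral_ge0 => s _; rewrite mule_ge0 ?rejection_ge0//.
by rewrite lee_fin sqr_ge0.
Qed.

End metropolis_hastings_positive.

(** * The acceptance ratio in terms of densities *)

Section tierney_ratio_density.
Context d (X : measurableType d) (R : realType).
Variables (pi : probability X R) (q : R.-pker X ~> X) (r : tierney_ratio pi q).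
Variables (lambda : {sigma_finite_measure set X -> \bar R}).
Variables (p : X -> R) (k : X * X -> R).
Hypotheses (mp : measurable_fun setT p) (p0 : forall x, (0 <= p x)%R).
Hypothesis piE : forall A, measurable A ->
  pi A = \int[lambda]_(x in A) (p x)%:E.
Hypotheses (mk : measurable_fun setT k) (k0 : forall z, (0 <= k z)%R).
Hypothesis kC : forall x y, k (x, y) = k (y, x).
Hypothesis qE : forall x A, measurable A ->
  q x A = \int[lambda]_(y in A) (k (x, y))%:E.

(** F and F' are the densities of pi(dx) q(x,dy) and of its transpose. *)
Let F (z : X * X) : R := (p z.1 * k z)%R.
Let F' (z : X * X) : R := (p z.2 * k z)%R.

Let mF : measurable_fun setT F.
Proof. by apply: measurable_funM => //; exact: measurableT_comp. Qed.

Let mF' : measurable_fun setT F'.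
Proof. by apply: measurable_funM => //; exact: measurableT_comp. Qed.

Let F0 z : (0 <= F z)%R. Proof. by rewrite mulr_ge0. Qed.
Let F'0 z : (0 <= F' z)%R. Proof. by rewrite mulr_ge0. Qed.

Let msec (g : X * X -> \bar R) x : measurable_fun setT g ->
  measurable_fun setT (fun y => g (x, y)).
Proof. by move=> mg; exact: measurableT_comp. Qed.

Let mksec x : measurable_fun setT (fun y => k (x, y)).
Proof. exact: measurableT_comp. Qed.

Let integral_fwd (g : X * X -> \bar R) : (forall z, 0 <= g z) ->
  measurable_fun setT g ->
  \int[semidirect pi q]_z g z = \int[lambda \x lambda]_z ((F z)%:E * g z).
Proof.
move=> g0 mg; rewrite ge0_integral_semidirect//.
have kg0 z : 0 <= (k z)%:E * g z by rewrite mule_ge0// lee_fin.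
have mkg : measurable_fun setT (fun z => (k z)%:E * g z).
  by apply: emeasurable_funM => //; exact/measurable_EFinP.
under eq_integral => x _.
  rewrite (ge0_integral_density (mksec x) _ (qE x))//; last exact: msec.
  over.
rewrite (ge0_integral_density mp _ piE)//; last 2 first.
- by move=> x; apply: integral_ge0.
- exact: (measurable_fun_fubini_tonelli_F (fun z => (k z)%:E * g z)).
rewrite fubini_tonelli1//; last 2 first.
- by apply: emeasurable_funM => //; exact/measurable_EFinP.
- by move=> z; rewrite mule_ge0// lee_fin.
apply: eq_integral => x _; rewrite /fubini_F.
rewrite -ge0_integralZl ?lee_fin//; last first.
  exact: (msec (g := fun z => (k z)%:E * g z)).
by apply: eq_integral => y _; rewrite /F EFinM muleA.
Qed.

Let fwdE A : measurable A ->
  semidirect pi q A = \int[lambda \x lambda]_(z in A) (F z)%:E.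
Proof.
move=> mA; rewrite -[LHS]mul1e -integral_cst// integral_mkcond.
rewrite integral_fwd//; last 2 first.
- by move=> z; rewrite patchE; case: ifP => // _; exact: lee01.
- by apply: ((measurable_restrictT _ mA).1 _) => //; exact: measurable_cst.
rewrite [RHS]integral_mkcond; apply: eq_integral => z _; rewrite !patchE.
by case: ifP => _; rewrite ?mule1 ?mule0.
Qed.

Let swap (z : X * X) := (z.2, z.1).

Let mswap : measurable_fun setT swap.
Proof. exact/measurable_fun_pair. Qed.

Let bwdE A : measurable A -> pushforward (semidirect pi q) swap A =
  \int[lambda \x lambda]_(z in A) (F' z)%:E.
Proof.
move=> mA; have mE : measurable (swap @^-1` A).
  by rewrite -[X in measurable X]setTI; exact: mswap.
rewrite /pushforward fwdE// integral_mkcond [RHS]integral_mkcond.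
rewrite fubini_tonelli1; last 2 first.
- apply: ((measurable_restrictT _ mE).1 _) => //.
  by apply: measurable_funTS; exact/measurable_EFinP.
- by move=> z; rewrite patchE; case: ifP => //; rewrite lee_fin.
rewrite fubini_tonelli2; last 2 first.
- apply: ((measurable_restrictT _ mA).1 _) => //.
  by apply: measurable_funTS; exact/measurable_EFinP.
- by move=> z; rewrite patchE; case: ifP => //; rewrite lee_fin.
apply: eq_integral => x _; apply: eq_integral => y _.
rewrite /fubini_F /fubini_G !patchE /F /F' /= (kC x y).
by rewrite (_ : ((x, y) \in swap @^-1` A) = ((y, x) \in A))// !in_setE.
Qed.

Let mEF : measurable_fun setT (EFin \o F). Proof. exact/measurable_EFinP. Qed.
Let mEF' : measurable_fun setT (EFin \o F'). Proof. exact/measurable_EFinP. Qed.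

Let mrF : measurable_fun setT (fun z => (r z * F z)%:E).
Proof.
apply/measurable_EFinP; apply: measurable_funM => //.
exact: measurable_ratio.
Qed.

(** On the region, r and F'/F are both densities of the transposed flow with
respect to the flow; the identity is multiplied by F to avoid dividing by 0. *)
Let region_densityE :
  ae_eq (lambda \x lambda) (region r) (EFin \o F') (fun z => (r z * F z)%:E).
Proof.
have mreg := measurable_region r.
apply: integral_ae_eq => //.
- apply: (integrableS measurableT) => //; apply/integrableP; split => //.
  under eq_integral => z _ do rewrite gee0_abs ?lee_fin//.
  rewrite -(bwdE measurableT) /pushforward preimage_setT.
  by rewrite (le_lt_trans (@probability_le1 _ _ _ _ _ _)) ?ltry.
- exact: measurable_funTS.
move=> E Er mE; rewrite -bwdE// (ratio_density mE Er).
rewrite [LHS]integral_mkcond; apply: (eq_trans (integral_fwd _ _)).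
- move=> z; rewrite patchE; case: ifP => // _.
  by rewrite lee_fin tierney_ratio_ge0.
- apply: ((measurable_restrictT _ mE).1 _) => //; apply: measurable_funTS.
  by apply/measurable_EFinP; exact: measurable_ratio.
rewrite [RHS]integral_mkcond; apply: eq_integral => z _; rewrite !patchE.
by case: ifP => _; rewrite ?mule0// -EFinM mulrC.
Qed.

(** Mutual singularity off the region, in terms of densities. *)
Let off_region_density : {ae (lambda \x lambda), forall z,
  ~ region r z -> F z = 0%R \/ F' z = 0%R}.
Proof.
have [B mB [Br fB bB]] := region_singular r.
have mC : measurable (~` region r `\` B).
  by apply: measurableD => //; apply: measurableC; exact: measurable_region.
have FB : ae_eq (lambda \x lambda) B (EFin \o F) (cst 0).
  apply/ae_eq_integral_abs => //; first exact: measurable_funTS.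
  under eq_integral => z _ do rewrite gee0_abs ?lee_fin//.
  by rewrite -fwdE.
have FC : ae_eq (lambda \x lambda) (~` region r `\` B) (EFin \o F') (cst 0).
  apply/ae_eq_integral_abs => //; first exact: measurable_funTS.
  under eq_integral => z _ do rewrite gee0_abs ?lee_fin//.
  by rewrite -bwdE.
apply: filterS2 FB FC => z FBz FCz rz.
have [Bz|Bz] := pselect (B z).
  by left; have [] := FBz Bz.
by right; have [] := FCz (conj rz Bz).
Qed.

(** On the region r F = F'.  Off the region r = 0, and the right-hand side also
vanishes because one of F and F' does.  The constant c will be the ratio u/w of
the weights; the null set must not depend on it. *)
Lemma tierney_ratio_minE : {ae (lambda \x lambda), forall z (c : R),
  (0 <= c)%R -> (p z.1 * k z * Num.min 1 (r z * c) =
                 Num.min (p z.1 * k z) (c * (p z.2 * k z)))%R}.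
Proof.
apply: filterS2 region_densityE off_region_density => z rz offz c c0.
rewrite -/(F z) -/(F' z) minr_pMr// mulr1.
have [zr|zr] := pselect (region r z).
  have [->] := rz zr; congr Num.min; ring.
rewrite ratio_off// mul0r mulr0.
by have [->|->] := offz zr; rewrite ?mulr0// !min_l ?mulr_ge0//.
Qed.

End tierney_ratio_density.

(** * The flow of accepted pseudo-marginal moves *)

Lemma sigma_finite_semidirect d d' (X : measurableType d)
    (Y : measurableType d') (R : realType)
    (lambda : {sigma_finite_measure set X -> \bar R}) (K : R.-pker X ~> Y) :
  sigma_finite setT (semidirect lambda K).
Proof.
have /sigma_finiteP[E [TE ndE Eoo]] := sigma_finiteT lambda.
exists (fun n => fst @^-1` E n).
  rewrite predeqE => -[x y]; split => // _.
  have [n _ En] : (\bigcup_i E i) x by rewrite -TE.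
  by exists n.
move=> n; have [mE En] := Eoo n; split.
  by rewrite -[X in measurable X]setTI; exact: measurable_fst.
apply: le_lt_trans En.
rewrite /= /semidirect -[leRHS]mul1e -integral_cst// [leRHS]integral_mkcond.
rewrite le_eqVlt; apply/orP; left; apply/eqP.
apply: eq_integral => x _; rewrite patchE.
have [xE|xE] := boolP (x \in E n).
  rewrite (_ : xsection _ x = setT) ?prob_kernel//.
  by apply/seteqP; split => y //= _; rewrite /xsection /= inE/=;
    move: xE; rewrite inE.
rewrite (_ : xsection _ x = set0) ?measure0//.
by apply/seteqP; split => y //=; rewrite /xsection /= inE /= => /mem_set;
  rewrite (negbTE xE).
Qed.

Section pseudo_marginal_density.
Context d (X : measurableType d) (R : realType).
Variables (pi : probability X R) (q : R.-pker X ~> X) (r : tierney_ratio pi q).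
Variables (W : nneg_borel R) (Q : weight_kernel X W).
Variables (lambda : {sigma_finite_measure set X -> \bar R}).
Variables (p : X -> R) (k : X * X -> R).
Hypotheses (mp : measurable_fun setT p) (p0 : forall x, (0 <= p x)%R).
Hypothesis piE : forall A, measurable A ->
  pi A = \int[lambda]_(x in A) (p x)%:E.
Hypotheses (mk : measurable_fun setT k) (k0 : forall z, (0 <= k z)%R).
Hypothesis kC : forall x y, k (x, y) = k (y, x).
Hypothesis qE : forall x A, measurable A ->
  q x A = \int[lambda]_(y in A) (k (x, y))%:E.

Local Notation S := (X * weight_space W)%type.

Let ms_sf := Measure_isSigmaFinite.Build _ _ _ (semidirect lambda Q)
  (sigma_finite_semidirect lambda Q).

Definition reference_measure : {sigma_finite_measure set S -> \bar R} :=
  HB.pack (semidirect lambda Q) ms_sf.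

Local Notation m := reference_measure.

(** The density of the target of the pseudo-marginal kernel with respect to
[reference_measure]. *)
Definition target_density (s : S) : R := (weight s.2 * p s.1)%R.

Local Notation wp := target_density.

(** The density of the accepted moves, the content of [acceptance_flowE]. *)
Definition acceptance_flow (z : S * S) : R :=
  (Num.min (wp z.1) (wp z.2) * k (z.1.1, z.2.1))%R.

Let mw : measurable_fun setT (fun w : weight_space W => (weight w)).
Proof. exact: measurable_weight. Qed.

Lemma measurable_target_density : measurable_fun setT wp.
Proof.
by apply: measurable_funM; apply: measurableT_comp.
Qed.

Let wp0 s : (0 <= wp s)%R.
Proof. by rewrite mulr_ge0// weight_ge0. Qed.

Let mksec x : measurable_fun setT (fun y => k (x, y)).
Proof. exact: measurableT_comp. Qed.

Let ge0_integral_m (g : S -> \bar R) : (forall s, 0 <= g s) ->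
  measurable_fun setT g ->
  \int[m]_s g s = \int[lambda]_x \int[Q x]_w g (x, w).
Proof. by move=> g0 mg; rewrite -ge0_integral_semidirect. Qed.

Let msec (g : S -> \bar R) x : measurable_fun setT g ->
  measurable_fun setT (fun y => g (x, y)).
Proof. by move=> mg; exact: measurableT_comp. Qed.

Lemma ge0_integral_pm_target (g : S -> \bar R) : (forall s, 0 <= g s) ->
  measurable_fun setT g ->
  \int[pm_target pi Q]_s g s = \int[m]_s ((wp s)%:E * g s).
Proof.
move=> g0 mg; rewrite [LHS]ge0_integral_semidirect//.
have mwg x : measurable_fun setT (fun w => (weight w)%:E * g (x, w)).
  by apply: emeasurable_funM; [exact/measurable_EFinP|exact: msec].
have mwg2 : measurable_fun setT (fun s : S => (weight s.2)%:E * g s).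
  apply: emeasurable_funM => //; apply/measurable_EFinP.
  exact: measurableT_comp.
under eq_integral => x _.
  rewrite (@ge0_integral_density _ _ _ (Q x) _ (@weight R W))//; last 2 first.
  - by move=> w; exact: weight_ge0.
  - exact: msec.
  over.
have wg0 s : 0 <= (weight s.2)%:E * g s.
  by rewrite mule_ge0// lee_fin weight_ge0.
rewrite (ge0_integral_density mp p0 piE)//; last 2 first.
- by move=> x; apply: integral_ge0 => w _; exact: (wg0 (x, w)).
- exact: (@measurable_integral_section _ _ _ _ _ Q
    (fun s : S => (weight s.2)%:E * g s)).
rewrite ge0_integral_m//; last 2 first.
- by move=> s; rewrite mule_ge0// lee_fin.
- apply: emeasurable_funM => //; apply/measurable_EFinP.
  exact: measurable_target_density.
apply: eq_integral => x _; rewrite -ge0_integralZl ?lee_fin//; last first.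
  by move=> w _; exact: (wg0 (x, w)).
by apply: eq_integral => w _; rewrite /wp /= EFinM -muleA muleCA.
Qed.

Lemma ge0_integral_lifted_proposal (s : S) (g : S -> \bar R) :
  (forall t, 0 <= g t) -> measurable_fun setT g ->
  \int[lifted_proposal q Q s]_t g t = \int[m]_t ((k (s.1, t.1))%:E * g t).
Proof.
move=> g0 mg; rewrite [LHS]ge0_integral_semidirect//.
rewrite (ge0_integral_density (mksec s.1) _ (qE s.1))//; last 2 first.
- by move=> x; exact: integral_ge0.
- exact: measurable_integral_section.
rewrite ge0_integral_m//; last 2 first.
- by move=> t; rewrite mule_ge0// lee_fin.
- apply: emeasurable_funM => //; apply/measurable_EFinP.
  exact: (measurableT_comp (mksec s.1)).
by apply: eq_integral => y _; rewrite -ge0_integralZl ?lee_fin//; exact: msec.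
Qed.

Lemma measurable_acceptance_flow : measurable_fun setT acceptance_flow.
Proof.
apply: measurable_funM.
  apply: measurable_minr; apply: measurableT_comp => //;
    exact: measurable_target_density.
apply: (measurableT_comp mk).
by apply/measurable_fun_pair; exact: measurableT_comp.
Qed.

Lemma acceptance_flow_ge0 z : (0 <= acceptance_flow z)%R.
Proof. by rewrite mulr_ge0// le_min !wp0. Qed.

Lemma acceptance_flowC s t : acceptance_flow (s, t) = acceptance_flow (t, s).
Proof. by rewrite /acceptance_flow /= minC kC. Qed.

Let integral_m_fst (g : X -> \bar R) : (forall x, 0 <= g x) ->
  measurable_fun setT g -> \int[m]_s g s.1 = \int[lambda]_x g x.
Proof.
move=> g0 mg; rewrite ge0_integral_m//; last exact: measurableT_comp.
by apply: eq_integral => x _ /=; rewrite integral_cst// prob_kernel mule1.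
Qed.

Let mproj : measurable_fun setT (fun z : S * S => (z.1.1, z.2.1)).
Proof. by apply/measurable_fun_pair; exact: measurableT_comp. Qed.

(** The projection of m to X is lambda because every Q_x is a probability, so
null sets of pairs of points of X lift to null sets of pairs of states. *)
Let ae_proj (T : X * X -> Prop) : {ae (lambda \x lambda), forall z, T z} ->
  {ae (m \x m), forall z, T (z.1.1, z.2.1)}.
Proof.
move=> [N [mN N0 NT]].
exists ((fun z : S * S => (z.1.1, z.2.1)) @^-1` N); split.
- by rewrite -[X in measurable X]setTI; exact: mproj.
- set N' := _ @^-1` N.
  have mN' : measurable N' by rewrite -[X in measurable X]setTI; exact: mproj.
  rewrite -[LHS]mul1e -integral_cst// integral_mkcond.
  rewrite fubini_tonelli1; last 2 first.
  + by apply: ((measurable_restrictT _ mN').1 _) => //; exact: measurable_cst.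
  + by move=> z; rewrite patchE; case: ifP => // _; exact: lee01.
  rewrite -N0 -[RHS]mul1e -integral_cst// [RHS]integral_mkcond.
  have m1N : measurable_fun setT ((cst 1) \_ N : X * X -> \bar R).
    by apply: ((measurable_restrictT _ mN).1 _) => //; exact: measurable_cst.
  have N10 z : 0 <= ((cst 1) \_ N : X * X -> \bar R) z.
    by rewrite patchE; case: ifP => // _; exact: lee01.
  rewrite [RHS]fubini_tonelli1//.
  rewrite -[RHS]integral_m_fst; last 2 first.
  + by move=> x; exact: integral_ge0.
  + exact: measurable_fun_fubini_tonelli_F.
  apply: eq_integral => s _; rewrite /fubini_F.
  by rewrite -[RHS]integral_m_fst//; exact: measurableT_comp.
- by move=> z nT; apply: NT.
Qed.

(** The weight w of the current state cancels the denominator of u/w, which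
turns the acceptance probability into the symmetric minimum of w p(x) and
u p(y).  At w = 0 both densities vanish. *)
Lemma acceptance_flowE (G : S * S -> \bar R) : (forall z, 0 <= G z) ->
  measurable_fun setT G ->
  \int[pm_target pi Q]_s \int[lifted_proposal q Q s]_t
    ((pm_acceptance r (s, t))%:E * G (s, t)) =
  \int[m \x m]_z ((acceptance_flow z)%:E * G z).
Proof.
move=> G0 mG.
pose H z := (pm_acceptance r z)%:E * G z.
have H0 z : 0 <= H z.
  by rewrite mule_ge0// lee_fin; case/andP: (pm_acceptance01 r z).
have mH : measurable_fun setT H.
  apply: emeasurable_funM => //; apply/measurable_EFinP.
  exact: measurable_pm_acceptance.
pose H2 (z : S * S) := (k (z.1.1, z.2.1))%:E * H z.
have H20 z : 0 <= H2 z by rewrite mule_ge0// lee_fin.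
have mH2 : measurable_fun setT H2.
  apply: emeasurable_funM => //; apply/measurable_EFinP.
  exact: (measurableT_comp mk).
rewrite ge0_integral_pm_target; last 2 first.
- by move=> s; apply: integral_ge0 => t _; exact: (H0 (s, t)).
- exact: (@measurable_integral_section _ _ _ _ _ (lifted_proposal q Q) H).
under eq_integral => s _.
  rewrite (ge0_integral_lifted_proposal s (g := fun t => H (s, t)))//;
    last exact: measurableT_comp.
  over.
transitivity (\int[m \x m]_z ((wp z.1)%:E * H2 z)).
  rewrite fubini_tonelli1; last 2 first.
  - apply: emeasurable_funM => //; apply/measurable_EFinP.
    exact: (measurableT_comp measurable_target_density).
  - by move=> z; rewrite mule_ge0// lee_fin.
  apply: eq_integral => s _; rewrite /fubini_F -ge0_integralZl ?lee_fin//.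
  - exact: (measurableT_comp mH2 (pair1_measurable s)).
  - by move=> t _; exact: (H20 (s, t)).
apply: ge0_ae_eq_integral => //.
- apply: emeasurable_funM => //; apply/measurable_EFinP.
  exact: (measurableT_comp measurable_target_density).
- apply: emeasurable_funM => //; apply/measurable_EFinP.
  exact: measurable_acceptance_flow.
- by move=> z _; rewrite mule_ge0// lee_fin.
- by move=> z _; rewrite mule_ge0// lee_fin acceptance_flow_ge0.
have := ae_proj (tierney_ratio_minE r mp p0 piE mk k0 kC qE).
apply: filterS => -[[x w] [y u]] /= minE _.
rewrite /H2 /H !muleA -!EFinM; congr (_%:E * _).
rewrite /acceptance_flow /wp /=; case: eqVneq => [->|w0].
  by rewrite !mul0r min_l ?mul0r// mulr_ge0// weight_ge0.
have wgt0 : (0 < weight w)%R by rewrite lt_neqAle eq_sym w0 weight_ge0.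
have c0 : (0 <= weight u / weight w)%R by rewrite divr_ge0// weight_ge0.
rewrite -!mulrA (mulrA (p x)) minE// minr_pMr ?weight_ge0// minr_pMl//.
by congr Num.min; field.
Qed.

End pseudo_marginal_density.

(** * Product of a minimum kernel and a Gram kernel *)

(** The integral of an extended-real function is the difference of those of its
positive and negative parts, and a difference with an infinite term is
infinite. *)
Lemma fin_num_integrable d (T : measurableType d) (R : realType)
    (mu : {measure set T -> \bar R}) (h : T -> \bar R) :
  measurable_fun setT h -> \int[mu]_t h t \is a fin_num ->
  mu.-integrable setT h.
Proof.
move=> mh; rewrite integralE fin_numB => /andP[hp hn].
apply/integrableP; split => //.
rewrite (eq_integral (h^\+ \+ h^\-)); last first.
  by move=> t _; rewrite -[RHS]/((h^\+ \+ h^\-) t) -fune_abse.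
rewrite ge0_integralD//; last 2 first.
- exact: measurable_funepos.
- exact: measurable_funeneg.
by rewrite ltey_eq fin_numD hp hn.
Qed.

Lemma integral_itv_tensor dZ (Z : measurableType dZ) (R : realType)
    (nu : {sigma_finite_measure set Z -> \bar R}) (e : Z -> \bar R) (c : R) :
  (0 <= c)%R -> nu.-integrable setT e ->
  \int[@lebesgue_measure R \x nu]_y
    ((\1_(`[0%R, c[%classic : set R) y.1)%:E * e y.2) = c%:E * \int[nu]_z e z.
Proof.
move=> c0 ie; have me := measurable_int _ ie.
have mc : measurable (`[0%R, c[%classic : set R) by exact: measurable_itv.
have m1c : measurable_fun setT
    (fun x : R => (\1_(`[0%R, c[%classic : set R) x)%:E : \bar R).
  by apply/measurable_EFinP; exact: measurable_indic.
have lebc : @lebesgue_measure R `[0%R, c[%classic = c%:E.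
  rewrite lebesgue_measure_itv/= lte_fin; case: ltP => [_|c_le0].
    by rewrite oppr0 adde0.
  by congr EFin; apply/eqP; rewrite eq_le c0.
pose h (y : measurableTypeR R * Z) : \bar R :=
  (\1_(`[0%R, c[%classic : set R) y.1)%:E * e y.2.
have mh : measurable_fun setT h.
  apply: emeasurable_funM; first exact: (measurableT_comp m1c measurable_fst).
  exact: measurableT_comp.
have ih : (@lebesgue_measure R \x nu).-integrable setT h.
  apply/(integrable12ltyP (@lebesgue_measure R) nu mh).2.
  under eq_integral => tau _.
    under eq_integral => z _ do rewrite /h abseM.
    rewrite /= ge0_integralZl//; last exact: measurableT_comp.
    over.
  rewrite /= ge0_integralZr//; last 2 first.
  - by apply/measurable_EFinP; apply: measurableT_comp => //;
      exact: measurable_indic.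
  - exact: integral_ge0.
  under eq_integral => tau _ do rewrite ger0_norm//.
  rewrite [X in X * _](_ : _ = c%:E); last first.
    by rewrite integral_indic// setIT; exact: lebc.
  rewrite lte_mul_pinfty ?lee_fin//.
  by have /integrableP[] := ie.
rewrite -(integral12_prod_meas1 ih) /fubini_F.
have efin : \int[nu]_z e z \is a fin_num by exact: integrable_fin_num.
under eq_integral => tau _.
  rewrite /h /= integralZl//.
  over.
rewrite /= -(fineK efin) integralZr//.
  congr (_ * _); rewrite integral_indic// setIT; exact: lebc.
apply/integrableP; split => //.
under eq_integral => tau _ do rewrite gee0_abs ?lee_fin//.
rewrite [ltLHS](_ : _ = c%:E) ?ltry//.
by rewrite integral_indic// setIT; exact: lebc.
Qed.

Section min_gram.
Context dS dZ (S : measurableType dS) (Z : measurableType dZ) (R : realType).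
Variables (nu : {sigma_finite_measure set Z -> \bar R}).
Variables (v : S -> R) (psi : Z * S -> R) (G : S * S -> R).
Hypotheses (mv : measurable_fun setT v) (v0 : forall s, (0 <= v s)%R).
Hypothesis mpsi : measurable_fun setT psi.
Hypothesis GE : forall s t,
  (G (s, t))%:E = \int[nu]_z (psi (z, s) * psi (z, t))%:E.

Let nu'_sf := Measure_isSigmaFinite.Build _ _ _ (@lebesgue_measure R \x nu)%E
  (sigma_finite_product_measure (@lebesgue_measure R) nu).

Definition subgraph_measure :
    {sigma_finite_measure set (measurableTypeR R * Z)%type -> \bar R} :=
  HB.pack (@lebesgue_measure R \x nu)%E nu'_sf.

(** The feature of s is supported on the part 0 <= tau < v s of the vertical
line, and the overlap of two such intervals has length min (v s) (v t). *)
Definition subgraph_feature (y : (measurableTypeR R * Z) * S) : R :=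
  if (0 <= y.1.1)%R && (y.1.1 < v y.2)%R then psi (y.1.2, y.2) else 0%R.

Lemma measurable_subgraph_feature : measurable_fun setT subgraph_feature.
Proof.
have m1 : measurable_fun setT (fun y : (measurableTypeR R * Z) * S => y.1.1).
  exact: (measurableT_comp measurable_fst).
have m2 : measurable_fun setT (fun y : (measurableTypeR R * Z) * S => y.1.2).
  exact: (measurableT_comp measurable_snd).
apply: measurable_fun_ifT => //.
  apply: measurable_and.
    by apply: measurable_fun_ler.
  by apply: measurable_fun_ltr => //; exact: measurableT_comp.
by apply: (measurableT_comp mpsi); apply/measurable_fun_pair.
Qed.

Lemma min_gramE s t : (Num.min (v s) (v t) * G (s, t))%:E =
  \int[subgraph_measure]_y
    (subgraph_feature (y, s) * subgraph_feature (y, t))%:E.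
Proof.
pose c := Num.min (v s) (v t).
have c0 : (0 <= c)%R by rewrite le_min !v0.
pose e z := (psi (z, s) * psi (z, t))%:E.
have me : measurable_fun setT e.
  by apply/measurable_EFinP; apply: measurable_funM; exact: measurableT_comp.
have ie : nu.-integrable setT e by apply: fin_num_integrable => //; rewrite -GE.
under eq_integral => y _.
  rewrite (_ : (subgraph_feature (y, s) * subgraph_feature (y, t))%:E =
    (\1_(`[0%R, c[%classic : set R) y.1)%:E * e y.2); last first.
    rewrite /e /subgraph_feature /= indicE mem_setE in_itv/= lt_min.
    case: (0 <= y.1)%R => /=; last by rewrite mul0r mul0e.
    case: (y.1 < v s)%R => /=; last by rewrite mul0r mul0e.
    case: (y.1 < v t)%R => /=; last by rewrite mulr0 mul0e.
    by rewrite mul1e.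
  over.
by rewrite [RHS](integral_itv_tensor c0 ie) -GE.
Qed.

End min_gram.

(** * Positivity of the pseudo-marginal kernel *)

Section pseudo_marginal_positive.
Context d dZ (X : measurableType d) (Z : measurableType dZ) (R : realType).
Variables (pi : probability X R) (q : R.-pker X ~> X) (r : tierney_ratio pi q).
Variables (W : nneg_borel R) (Q : weight_kernel X W).
Variables (lambda : {sigma_finite_measure set X -> \bar R}).
Variables (nu : {sigma_finite_measure set Z -> \bar R}).
Variables (p : X -> R) (k : X * X -> R) (eta : Z * X -> R).

(** Common form of both cases: a reference measure lambda for which pi has a
density and the proposal has a density k that is the Gram kernel of eta.  The
Gram representation also supplies the symmetry of k. *)
Lemma pm_positive_operator :
  measurable_fun setT p -> (forall x, (0 <= p x)%R) ->
  (forall A, measurable A -> pi A = \int[lambda]_(x in A) (p x)%:E) ->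
  measurable_fun setT k -> (forall z, (0 <= k z)%R) ->
  (forall x A, measurable A -> q x A = \int[lambda]_(y in A) (k (x, y))%:E) ->
  measurable_fun setT eta ->
  (forall x y, (k (x, y))%:E = \int[nu]_z (eta (z, x) * eta (z, y))%:E) ->
  positive_operator (pm_target pi Q) (pm_kernel Q r).
Proof.
move=> mp p0 piE mk k0 qE meta kE.
have kC x y : k (x, y) = k (y, x).
  apply: EFin_inj; rewrite !kE; apply: eq_integral => z _.
  by rewrite mulrC.
apply: (@mh_positive_operator _ _ _ _ _ _ _ _ (reference_measure Q lambda)
  (acceptance_flow p k)).
- exact: measurable_acceptance_flow.
- by move=> z; exact: acceptance_flow_ge0.
- by move=> s t; exact: acceptance_flowC.
- by move=> G G0 mG; exact: acceptance_flowE.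
move=> f mf intf.
(* The test function is absorbed into the features, so that the form becomes the
   total mass of a Gram kernel. *)
pose psi (zs : Z * (X * weight_space W)) : R := (f zs.2 * eta (zs.1, zs.2.1))%R.
have mpsi : measurable_fun setT psi.
  apply: measurable_funM; first exact: measurableT_comp.
  apply: (measurableT_comp meta); apply/measurable_fun_pair => //.
  exact: (measurableT_comp measurable_fst).
pose G (z : (X * weight_space W) * (X * weight_space W)) : R :=
  (f z.1 * f z.2 * k (z.1.1, z.2.1))%R.
have GE s t : (G (s, t))%:E = \int[nu]_z (psi (z, s) * psi (z, t))%:E.
  rewrite /G /= EFinM kE -integralZl//; last first.
    apply: fin_num_integrable; last by rewrite -kE.
    by apply/measurable_EFinP; apply: measurable_funM; exact: measurableT_comp.
  by apply: eq_integral => z _; rewrite -EFinM /psi /= mulrACA.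
have wp0 (s : X * weight_space W) : (0 <= target_density p s)%R.
  by rewrite mulr_ge0// weight_ge0.
apply: (@gram_integral_ge0 _ _ _ _ _ _ (subgraph_measure nu)
  (subgraph_feature (target_density p) psi)
  (fun z => acceptance_flow p k z * (f z.1 * f z.2))%R) => //.
- apply: measurable_subgraph_feature => //.
  exact: measurable_target_density.
- move=> s t; rewrite -(min_gramE wp0 mpsi GE); congr EFin.
  by rewrite /acceptance_flow /G /=; ring.
Qed.

End pseudo_marginal_positive.

Lemma positive_operator_left_gap_gt0 d (T : measurableType d) (R : realType)
    (mu : probability T R) (P : R.-pker T ~> T) :
  positive_operator mu P -> 0 < left_gap mu P.
Proof.
move=> P0; apply: (@lt_le_trans _ _ 1) => //.
rewrite /left_gap leeDl//; apply: le_ereal_inf_tmp => _ [g [mg _ g2] <-].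
by apply: P0 => //; rewrite g2 ltry.
Qed.

Lemma dominated_real_density d (X : measurableType d) (R : realType)
    (mu pi : probability X R) : pi `<< mu ->
  exists p : X -> R, [/\ measurable_fun setT p, forall x, (0 <= p x)%R &
    forall A, measurable A -> pi A = \int[mu]_(x in A) (p x)%:E].
Proof.
move=> /radon_nikodym_sigma_finite[g [g0 gfin ig gE]].
exists (fine \o g); split.
- by apply: measurableT_comp => //; exact: measurable_int ig.
- by move=> x; rewrite /= fine_ge0.
- move=> A mA; rewrite gE//; apply: eq_integral => x _.
  by rewrite /= fineK.
Qed.

(** The reference measure is the proposal itself, so k = 1, the Gram kernel of
the constant feature 1 for the probability q0. *)
Lemma imh_positive_operator d (X : measurableType d) (R : realType)
    (pi : probability X R) (q : R.-pker X ~> X) (r : tierney_ratio pi q)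
    (W : nneg_borel R) (Q : weight_kernel X W) :
  is_imh pi q -> positive_operator (pm_target pi Q) (pm_kernel Q r).
Proof.
move=> [q0 [qE /dominated_real_density[p [mp p0 piE]]]].
apply: (@pm_positive_operator _ _ X X R pi q r W Q q0 q0 p (cst 1%R) (cst 1%R))
  => //.
- by move=> x A mA; rewrite qE// (eq_integral (cst 1))// integral_cst// mul1e.
- move=> x y; rewrite (eq_integral (cst 1)); last first.
    by move=> z _; rewrite /= mul1r.
  by rewrite integral_cst// mul1e; apply/esym; exact: probability_setT.
Qed.

Lemma measurable_tuple_sub (R : realType) n :
  measurable_fun setT (fun z : n.-tuple R * n.-tuple R => tuple_sub z.2 z.1).
Proof.
apply: (measurable_fun_tnthP _).2 => i.
rewrite (_ : _ \o _ = fun z : n.-tuple R * n.-tuple R =>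
    (tnth z.2 i - tnth z.1 i)%R); last first.
  by apply/funext => z; rewrite /= tnth_mktuple.
apply: measurable_funB.
  exact: (measurableT_comp (measurable_tnth i) measurable_snd).
exact: (measurableT_comp (measurable_tnth i) measurable_fst).
Qed.

Lemma rwm_positive_operator (R : realType) n
    (pi : probability (n.-tuple R) R)
    (q : R.-pker (n.-tuple R) ~> (n.-tuple R)) (r : tierney_ratio pi q)
    (W : nneg_borel R) (Q : weight_kernel (n.-tuple R) W)
    (qt : n.-tuple R -> R) (eta : n.-tuple R * n.-tuple R -> R) :
  is_rwm pi q qt -> measurable_fun setT eta ->
  (forall x y : n.-tuple R, (qt (tuple_sub y x))%:E =
    \int[lebesgue_tuple R n]_z (eta (z, x) * eta (z, y))%:E) ->
  positive_operator (pm_target pi Q) (pm_kernel Q r).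
Proof.
move=> [[p [mp p0 piE]] _ _ mqt qE] meta etaE.
apply: (@pm_positive_operator _ _ _ _ R pi q r W Q (lebesgue_tuple R n)
  (lebesgue_tuple R n) p (fun z => qt (tuple_sub z.2 z.1)) eta) => //.
- exact: (measurableT_comp mqt (@measurable_tuple_sub R n)).
- by move=> z; have [_ ] := qE z.1.
- by move=> x A mA; have [_ _] := qE x; exact.
Qed.

Theorem proposition16 (R : realType) :
  (forall (d : measure_display) (X : measurableType d)
     (pi : probability X R) (q : R.-pker X ~> X) (r : tierney_ratio pi q)
     (W : nneg_borel R) (Q : weight_kernel X W),
     is_imh pi q ->
     positive_operator (pm_target pi Q) (pm_kernel Q r) /\
     0 < left_gap (pm_target pi Q) (pm_kernel Q r))
  /\
  (forall (n : nat) (pi : probability (n.-tuple R) R)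
     (q : R.-pker (n.-tuple R) ~> (n.-tuple R)) (r : tierney_ratio pi q)
     (W : nneg_borel R) (Q : weight_kernel (n.-tuple R) W)
     (qt : n.-tuple R -> R),
     is_rwm pi q qt ->
     (exists eta : n.-tuple R * n.-tuple R -> R,
        measurable_fun setT eta /\
        forall x y : n.-tuple R, (qt (tuple_sub y x))%:E =
          \int[lebesgue_tuple R n]_z (eta (z, x) * eta (z, y))%:E) ->
     positive_operator (pm_target pi Q) (pm_kernel Q r) /\
     0 < left_gap (pm_target pi Q) (pm_kernel Q r)).
Proof.
split.
- move=> d X pi q r W Q imh.
  have pos : positive_operator (pm_target pi Q) (pm_kernel Q r).
    exact: imh_positive_operator.
  by split => //; exact: positive_operator_left_gap_gt0.
- move=> n pi q r W Q qt rwm [eta [meta etaE]].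
  have pos : positive_operator (pm_target pi Q) (pm_kernel Q r).
    exact: rwm_positive_operator rwm meta etaE.
  by split => //; exact: positive_operator_left_gap_gt0.
Qed.
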